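(* Let $\mathbf{f},\mathbf{r},\mathbf{d},\mathbf{b},\mathbf{t}$ be the ideals in $\mathbb{N}$ of, respectively, finite sets, sets with convergent reciprocal series, sets of density zero, sets of Banach density zero, and sets of tile density zero, and write $c_0=\mathbf{f}c_0$. None of the following quotient maps $q:X\to X/E$ admits a uniformly continuous right inverse (a uniformly continuous $\tau:X/E\to X$ with $q\circ\tau=\mathrm{id}_{X/E}$): (1) $X=\ell^\infty$ and $E$ any one of $c_0$, $(\mathbf{t}\cap\mathbf{r})c_0$, $(\mathbf{b}\cap\mathbf{r})c_0$, $\mathbf{r}c_0$, $\mathbf{t}c_0$, $\mathbf{b}c_0$, $\mathbf{d}c_0$; (2) $X=\mathbf{d}c_0$ and $E$ any one of $c_0$, $(\mathbf{t}\cap\mathbf{r})c_0$, $(\mathbf{b}\cap\mathbf{r})c_0$, $\mathbf{r}c_0$, $\mathbf{t}c_0$, $\mathbf{b}c_0$; (3) $X=\mathbf{b}c_0$ and $E$ any one of $c_0$, $(\mathbf{t}\cap\mathbf{r})c_0$, $(\mathbf{b}\cap\mathbf{r})c_0$, $\mathbf{t}c_0$; (4) $X=\mathbf{r}c_0$ and $E$ any one of $c_0$, $(\mathbf{t}\cap\mathbf{r})c_0$, $(\mathbf{b}\cap\mathbf{r})c_0$; (5) $X=\mathbf{t}c_0$ and $E$ any one of $c_0$, $(\mathbf{t}\cap\mathbf{r})c_0$; (6) $X=(\mathbf{b}\cap\mathbf{r})c_0$ and $E$ any one of $c_0$, $(\mathbf{t}\cap\mathbf{r})c_0$; (7) $X=(\mathbf{t}\cap\mathbf{r})c_0$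 and $E=c_0$.
   Context: All vector spaces are over $\mathbb{R}$. $\mathbb{N}=\{1,2,3,\ldots\}$, $\mathbb{N}_0=\mathbb{N}\cup\{0\}$; for integers $a\le b$, $[a,b]=\{a,a+1,\ldots,b\}$; for $K\subseteq\mathbb{N}_0$ and $a\in\mathbb{N}_0$, $K+a=\{k+a: k\in K\}$; $|B|$ is the cardinality of $B$. A set $\mathbf{i}\subseteq 2^{\mathbb{N}}$ is an ideal in $\mathbb{N}$ if (1) $A,B\in\mathbf{i}$ implies $A\cup B\in\mathbf{i}$, and (2) $A\in\mathbf{i}$ and $B\subseteq A$ imply $B\in\mathbf{i}$. A real sequence $(r_n)_{n\in\mathbb{N}}$ $\mathbf{i}$-converges to $r\in\mathbb{R}$ if $\{n\in\mathbb{N}: |r_n-r|\geq\varepsilon\}\in\mathbf{i}$ for every $\varepsilon>0$. $\ell^\infty$ is the space of bounded real sequences with the supremum norm, and $\mathbf{i}c_0$ denotes the closed subspace of $\ell^\infty$ of all bounded sequences that $\mathbf{i}$-converge to $0$. The ideals are defined as follows. - $\mathbf{f}$ is the ideal of all finite subsets of $\mathbb{N}$. For $C,D\subseteq\mathbb{N}$, $C\subseteq D \bmod \mathbf{f}$ means $C\subseteq D\cup F$ for some $F\in\mathbf{f}$. - $\mathbf{r}=\{X\subseteq\mathbb{N}:\sum_{x\in X}x^{-1}<\infty\}$. - The density of $X\subseteq\mathbb{N}$ is $d(X)=\lim_{n\to\infty}|X\cap[1,n]|/n$ (if this limit exists), and $\mathbf{d}=\{X\subseteq\mathbb{N}: d(X)=0\}$.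 - The Banach density of $X\subseteq\mathbb{N}$ is $b(X)=\lim_{n\to\infty}\max_{k\in\mathbb{N}_0}|X\cap[k+1,k+n]|/n$, and $\mathbf{b}=\{X\subseteq\mathbb{N}: b(X)=0\}$. - For $r\in\mathbb{N}$ let $\mathcal{T}_r=2^{[0,r-1]}$, and let $\mathcal{T}=\left\{\left(\bigcup_{j=0}^\infty (T+jr)\right)+b : r,b\in\mathbb{N},\ T\in\mathcal{T}_r\right\}\subseteq 2^{\mathbb{N}}$. The tile density of $X\subseteq\mathbb{N}$ is $\mathrm{tile}(X)=\inf\{d(A): A\in\mathcal{T},\ X\subseteq A \bmod \mathbf{f}\}$, and $\mathbf{t}=\{X\subseteq\mathbb{N}:\mathrm{tile}(X)=0\}$. *)

(* Defs.v *)
From HB Require Import structures.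
From mathcomp Require Import all_boot all_order all_algebra.
From mathcomp Require Import finmap.
From mathcomp Require Import all_classical all_reals all_analysis.
From mathcomp Require Import zify ring lra.
Set Implicit Arguments.
Unset Strict Implicit.
Unset Printing Implicit Defensive.

Import Order.TTheory GRing.Theory Num.Theory.
Import numFieldNormedType.Exports.

Local Open Scope classical_set_scope.
Local Open Scope ring_scope.
Local Open Scope quotient_scope.

Record closedSubspace (R : realType) (V : normedModType R) := ClosedSubspace {
  subspace_set :> V -> Prop;
  subspace0 : subspace_set 0;
  subspaceD : forall x y,
    subspace_set x -> subspace_set y -> subspace_set (x + y);
  subspaceZ : forall a x, subspace_set x -> subspace_set (a *: x);
  subspace_closed : closed subspace_set }.

Section ClosedSubspaceTheory.
Context (R : realType) (V : normedModType R) (E : closedSubspace V).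

Definition in_subspace : {pred V} := mem (subspace_set E : set V).

Lemma in_subspaceE x : (x \in in_subspace) = (x \in (subspace_set E : set V)).
Proof. by []. Qed.

Lemma in_subspaceP x : reflect (E x) (x \in in_subspace).
Proof. by apply: (iffP idP); rewrite in_subspaceE in_setE. Qed.

Lemma in_subspace_submod_closed : submod_closed in_subspace.
Proof.
split=> [|a x y /in_subspaceP Ex /in_subspaceP Ey]; apply/in_subspaceP.
  exact: subspace0.
by apply: subspaceD => //; exact: subspaceZ.
Qed.

Lemma in_subspace_oppr_closed : oppr_closed in_subspace.
Proof.
move=> x /in_subspaceP Ex; apply/in_subspaceP.
by rewrite -scaleN1r; exact: subspaceZ.
Qed.

HB.instance Definition _ := GRing.isSubmodClosed.Build R V in_subspace
  in_subspace_submod_closed.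
HB.instance Definition _ := GRing.isOppClosed.Build V in_subspace
  in_subspace_oppr_closed.

Record subspace_type := SubspaceType {
  subspace_val :> V;
  _ : subspace_val \in in_subspace }.

HB.instance Definition _ := [isSub for subspace_val].
HB.instance Definition _ := [Choice of subspace_type by <:].
HB.instance Definition _ := [SubChoice_isSubLmodule of subspace_type by <:].

Definition subspace_norm (x : subspace_type) : R := `|val x|.

Lemma subspace_normD x y :
  subspace_norm (x + y) <= subspace_norm x + subspace_norm y.
Proof. by rewrite /subspace_norm raddfD; exact: ler_normD. Qed.

Lemma subspace_normZ a x : subspace_norm (a *: x) = `|a| * subspace_norm x.
Proof. by rewrite /subspace_norm linearZ normrZ. Qed.

Lemma subspace_norm0_eq0 x : subspace_norm x = 0 -> x = 0.
Proof. by move/normr0_eq0 => x0; apply: val_inj; rewrite x0 raddf0. Qed.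

HB.instance Definition _ :=
  Lmodule_isNormed.Build R subspace_type
    subspace_normD subspace_normZ subspace_norm0_eq0.

Lemma subspace_normE (x : subspace_type) : `|x| = `|val x|.
Proof. by []. Qed.

Definition quotient := Quotient.quot in_subspace.
HB.instance Definition _ := GRing.Zmodule.on quotient.

Definition quotient_map (x : V) : quotient := \pi_(Quotient.quot in_subspace) x.

Lemma quotient_mapP x y : quotient_map x = quotient_map y <-> E (x - y).
Proof.
split=> [xy|Exy]; [apply/in_subspaceP|apply/eqP].
  by rewrite Quotient.idealrBE; apply/eqP.
by rewrite -Quotient.idealrBE; apply/in_subspaceP.
Qed.

Lemma quotient_map_surj (A : quotient) : exists x, quotient_map x = A.
Proof. by exists (repr A); exact: reprK. Qed.

Lemma quotient_mapD : {morph quotient_map : x y / x + y}.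
Proof. by move=> x y; exact: raddfD. Qed.

Definition quotient_scale (a : R) (A : quotient) : quotient :=
  quotient_map (a *: repr A).

Lemma quotient_scaleE a x :
  quotient_scale a (quotient_map x) = quotient_map (a *: x).
Proof.
apply/quotient_mapP; rewrite -scalerBr; apply: subspaceZ; apply/quotient_mapP.
exact: reprK.
Qed.

Lemma quotient_scaleA a b A :
  quotient_scale a (quotient_scale b A) = quotient_scale (a * b) A.
Proof.
by have [x <-] := quotient_map_surj A; rewrite !quotient_scaleE scalerA.
Qed.

Lemma quotient_scale1 : left_id 1 quotient_scale.
Proof.
by move=> A; have [x <-] := quotient_map_surj A;
  rewrite quotient_scaleE scale1r.
Qed.

Lemma quotient_scaleDr : right_distributive quotient_scale +%R.
Proof.
move=> a A B; have [x <-] := quotient_map_surj A.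
have [y <-] := quotient_map_surj B.
by rewrite -quotient_mapD !quotient_scaleE scalerDr quotient_mapD.
Qed.

Lemma quotient_scaleDl A : {morph quotient_scale^~ A : a b / a + b}.
Proof.
move=> a b; have [x <-] := quotient_map_surj A.
by rewrite !quotient_scaleE scalerDl quotient_mapD.
Qed.

HB.instance Definition _ := GRing.Zmodule_isLmodule.Build R quotient
  quotient_scaleA quotient_scale1 quotient_scaleDr quotient_scaleDl.

Lemma quotient_mapZ a x : quotient_map (a *: x) = a *: quotient_map x.
Proof. by rewrite -quotient_scaleE. Qed.

Definition quotient_norms (A : quotient) : set R :=
  [set `|x| | x in [set x | quotient_map x = A]].

Definition quotient_norm A : R := inf (quotient_norms A).

Lemma quotient_norm_has_inf A : has_inf (quotient_norms A).
Proof.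
split; last by exists 0 => _ [x _ <-].
by have [x xA] := quotient_map_surj A; exists `|x|, x.
Qed.

Lemma quotient_norm_le x : quotient_norm (quotient_map x) <= `|x|.
Proof.
by apply: ge_inf; [have [] := quotient_norm_has_inf (quotient_map x)|exists x].
Qed.

Lemma quotient_norm_lt A e : quotient_norm A < e ->
  exists2 x, quotient_map x = A & `|x| < e.
Proof.
move=> /inf_lt[|_ [x xA <-] xe]; last by exists x.
by have [] := quotient_norm_has_inf A.
Qed.

Lemma quotient_norm_ge0 A : 0 <= quotient_norm A.
Proof.
apply: lb_le_inf; first by have [] := quotient_norm_has_inf A.
by move=> _ [x _ <-].
Qed.

Lemma quotient_normD A B :
  quotient_norm (A + B) <= quotient_norm A + quotient_norm B.
Proof.
apply/ler_addgt0Pr => e e0; have e2 : 0 < e / 2 by rewrite divr_gt0.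
have [x <- xe] : exists2 x, quotient_map x = A & `|x| < quotient_norm A + e / 2.
  by apply: quotient_norm_lt; rewrite ltrDl.
have [y <- ye] : exists2 y, quotient_map y = B & `|y| < quotient_norm B + e / 2.
  by apply: quotient_norm_lt; rewrite ltrDl.
rewrite -quotient_mapD; apply: (le_trans (quotient_norm_le _)).
have := ler_normD x y; lra.
Qed.

Lemma quotient_normZ_le a A : quotient_norm (a *: A) <= `|a| * quotient_norm A.
Proof.
apply/ler_addgt0Pr => e e0.
have a1 : 0 < `|a| + 1 by rewrite ltr_wpDl.
have [x <- xe] : exists2 x, quotient_map x = A &
    `|x| < quotient_norm A + e / (`|a| + 1).
  by apply: quotient_norm_lt; rewrite ltrDl divr_gt0.
rewrite -quotient_mapZ; apply: (le_trans (quotient_norm_le _)).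
rewrite normrZ; apply: (le_trans (ler_wpM2l (normr_ge0 _) (ltW xe))).
rewrite mulrDr lerD2l mulrCA ger_pMr// ler_pdivrMr// mul1r lerDl//.
Qed.

Lemma quotient_normZ a A : quotient_norm (a *: A) = `|a| * quotient_norm A.
Proof.
apply/eqP; rewrite eq_le quotient_normZ_le/=.
have [->|a0] := eqVneq a 0.
  by rewrite normr0 mul0r quotient_norm_ge0.
rewrite -ler_pdivlMl ?normr_gt0// -normfV.
by apply: (le_trans _ (quotient_normZ_le _ _)); rewrite scalerA mulVf// scale1r.
Qed.

Lemma quotient_norm0_eq0 A : quotient_norm A = 0 -> A = 0.
Proof.
have [x <-] := quotient_map_surj A => x0.
have -> : 0 = quotient_map 0 
  by apply: esym; exact: (raddf0 \pi_(Quotient.quot in_subspace)).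
apply/quotient_mapP; rewrite subr0.
apply: (@subspace_closed _ _ E) => B /nbhs_ballP[e /= e0 eB].
have [y yx ye] : exists2 y, quotient_map y = quotient_map x & `|y| < e.
  by apply: quotient_norm_lt; rewrite x0.
exists (x - y); split; first exact/quotient_mapP.
by apply: eB; rewrite -ball_normE /ball_/= opprB addrC subrK.
Qed.

HB.instance Definition _ :=
  Lmodule_isNormed.Build R quotient
    quotient_normD quotient_normZ quotient_norm0_eq0.

End ClosedSubspaceTheory.
Arguments quotient_map {R V} E x.

Section TraceSubspace.
Context (R : realType) (V : normedModType R) (X E : closedSubspace V).

Definition trace_set : set (subspace_type X) := [set x | E (val x)].

Lemma trace0 : trace_set 0. Proof. exact: subspace0. Qed.

Lemma traceD x y : trace_set x -> trace_set y -> trace_set (x + y).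
Proof. exact: subspaceD. Qed.

Lemma traceZ a x : trace_set x -> trace_set (a *: x).
Proof. exact: subspaceZ. Qed.

Lemma trace_closed : closed trace_set.
Proof.
move=> x clx; apply: (@subspace_closed _ _ E) => B /nbhs_ballP[e /= e0 eB].
have [y [Ey xy]] := clx _ (nbhsx_ballx x e e0).
exists (val y); split => //; apply: eB; rewrite -ball_normE /ball_/=.
by rewrite -ball_normE in xy.
Qed.

(* [E] intersected with [X], as a subspace of the normed space [X]; it is [E]
   itself when [E] is contained in [X]. *)
Definition trace_subspace : closedSubspace (subspace_type X) :=
  ClosedSubspace trace0 traceD traceZ trace_closed.

End TraceSubspace.

(* The uniform structure of [quotient E] is that of the quotient norm. *)
Definition has_uc_right_inverse (R : realType) (V : normedModType R)
    (E : closedSubspace V) : Prop :=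
  exists2 tau : quotient E -> V,
    unif_continuous tau & cancel tau (quotient_map E).

(* The index set of the sequences: the natural numbers start at 1. *)
Definition posnat := {n : nat | (0 < n)%N}.

Section BoundedSequences.
Context (R : realType).

Definition bounded_seq (u : posnat -> R) := exists M, forall n, `|u n| <= M.

Definition linfty_pred : {pred posnat -> R} := mem [set u | bounded_seq u].

Lemma linfty_predP u : reflect (bounded_seq u) (u \in linfty_pred).
Proof.
apply: (iffP idP) => [|bu]; rewrite /linfty_pred -topredE/=.
  by rewrite in_setE.
by rewrite in_setE.
Qed.

Lemma linfty_submod_closed : submod_closed linfty_pred.
Proof.
split=> [|a u v /linfty_predP[M uM] /linfty_predP[L vL]]; apply/linfty_predP.
  by exists 0 => n; rewrite normr0.
exists (`|a| * M + L) => n; apply: (le_trans (ler_normD _ _)).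
by rewrite lerD// normrM ler_wpM2l.
Qed.

HB.instance Definition _ := GRing.isSubmodClosed.Build R (posnat -> R)
  linfty_pred linfty_submod_closed.

Record linfty := Linfty {
  linfty_seq :> posnat -> R;
  _ : linfty_seq \in linfty_pred }.

HB.instance Definition _ := [isSub for linfty_seq].
HB.instance Definition _ := [Choice of linfty by <:].
HB.instance Definition _ := [SubChoice_isSubLmodule of linfty by <:].

Definition sup_norm (u : linfty) : R := sup (range (fun n => `|u n|)).

Lemma sup_norm_has_sup (u : linfty) : has_sup (range (fun n => `|u n|)).
Proof.
split; first by exists `|u (exist _ 1%N isT)|, (exist _ 1%N isT).
have /linfty_predP[M uM] := valP u.
by exists M => _ [n _ <-].
Qed.

Lemma sup_norm_ub (u : linfty) n : `|u n| <= sup_norm u.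
Proof. by apply: ub_le_sup; [exact: (sup_norm_has_sup u).2|exists n]. Qed.

Lemma sup_norm_le (u : linfty) M : (forall n, `|u n| <= M) -> sup_norm u <= M.
Proof.
move=> uM; apply: ge_sup; first exact: (sup_norm_has_sup u).1.
by move=> _ [n _ <-].
Qed.

Lemma sup_normD u v : sup_norm (u + v) <= sup_norm u + sup_norm v.
Proof.
apply: sup_norm_le => n; apply: (le_trans (ler_normD _ _)).
by rewrite lerD ?sup_norm_ub.
Qed.

Lemma sup_normZ_le a u : sup_norm (a *: u) <= `|a| * sup_norm u.
Proof.
by apply: sup_norm_le => n; rewrite normrM ler_wpM2l ?sup_norm_ub.
Qed.

Lemma sup_normZ a u : sup_norm (a *: u) = `|a| * sup_norm u.
Proof.
apply/eqP; rewrite eq_le sup_normZ_le/=.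
have [->|a0] := eqVneq a 0.
  rewrite normr0 mul0r; apply: (le_trans (normr_ge0 _)).
  exact: (sup_norm_ub _ (exist _ 1%N isT)).
rewrite -ler_pdivlMl ?normr_gt0// -normfV.
by apply: (le_trans _ (sup_normZ_le _ _)); rewrite scalerA mulVf// scale1r.
Qed.

Lemma sup_norm0_eq0 u : sup_norm u = 0 -> u = 0.
Proof.
move=> u0; apply/val_inj/funext => n; apply/eqP.
by rewrite -normr_le0 -[leRHS]u0; exact: sup_norm_ub.
Qed.

HB.instance Definition _ :=
  Lmodule_isNormed.Build R linfty sup_normD sup_normZ sup_norm0_eq0.

Lemma linfty_normE (u : linfty) : `|u| = sup (range (fun n => `|u n|)).
Proof. by []. Qed.

End BoundedSequences.

(* The field [ideal0] only excludes the empty family: with [idealS] it is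
   equivalent to being nonempty. *)
Record ideal := Ideal {
  ideal_sets :> set posnat -> Prop;
  ideal0 : ideal_sets set0;
  idealU : forall A B, ideal_sets A -> ideal_sets B -> ideal_sets (A `|` B);
  idealS : forall A B, ideal_sets A -> B `<=` A -> ideal_sets B }.

Section IdealConvergence.
Context (R : realType) (i : ideal).

Definition ideal_cvg (u : posnat -> R) (l : R) : Prop :=
  forall e, 0 < e -> i [set n | e <= `|u n - l|].

Definition ic0_set : set (linfty R) := [set u | ideal_cvg u 0].

Lemma ic0_0 : ic0_set 0.
Proof.
move=> e e0; apply: (idealS (ideal0 i)) => n /=.
by rewrite subrr normr0 leNgt e0.
Qed.

Lemma ic0_D u v : ic0_set u -> ic0_set v -> ic0_set (u + v).
Proof.
move=> u0 v0 e e0; have e2 : 0 < e / 2 by rewrite divr_gt0.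
apply: (idealS (idealU (u0 _ e2) (v0 _ e2))) => n /=; rewrite !subr0 => uve.
have [ue|ue] := leP (e / 2) `|u n|; [by left|right].
have : e <= `|u n| + `|v n| by apply: (le_trans uve); exact: ler_normD.
lra.
Qed.

Lemma ic0_Z a u : ic0_set u -> ic0_set (a *: u).
Proof.
move=> u0 e e0; have a1 : 0 < `|a| + 1 by rewrite ltr_wpDl.
apply: (idealS (u0 (e / (`|a| + 1)) (divr_gt0 e0 a1))) => n /=.
rewrite !subr0 ler_pdivrMr// => /le_trans; apply.
by rewrite normrM mulrC ler_wpM2l// lerDl.
Qed.

Lemma ic0_closed : closed ic0_set.
Proof.
move=> u clu e e0; have e2 : 0 < e / 2 by rewrite divr_gt0.
have [v [v0 uv]] := clu _ (nbhsx_ballx u (e / 2) e2).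
apply: (idealS (v0 _ e2)) => n /=; rewrite !subr0 => ue.
have : `|(u - v) n| < e / 2.
  by apply: le_lt_trans (sup_norm_ub _ n) _; rewrite -ball_normE in uv.
rewrite /= => uvn.
have : `|u n| <= `|u n - v n| + `|v n|.
  by rewrite -{1}(subrK (v n) (u n)) ler_normD.
have -> : `|u n - v n| = `|(u - v) n| by [].
lra.
Qed.

Definition ic0 : closedSubspace (linfty R) :=
  ClosedSubspace ic0_0 ic0_D ic0_Z ic0_closed.

End IdealConvergence.

Section IdealIntersection.
Variables i j : ideal.
Definition idealI_sets : set (set posnat) := ideal_sets i `&` ideal_sets j.

Lemma idealI0 : idealI_sets set0. Proof. by split; exact: ideal0. Qed.

Lemma idealIU A B : idealI_sets A -> idealI_sets B -> idealI_sets (A `|` B).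
Proof. by move=> [iA jA] [iB jB]; split; exact: idealU. Qed.

Lemma idealIS A B : idealI_sets A -> B `<=` A -> idealI_sets B.
Proof. by move=> [iA jA] BA; split; exact: idealS BA. Qed.

Definition idealI : ideal := Ideal idealI0 idealIU idealIS.
End IdealIntersection.

Definition mkpos n (n0 : (0 < n)%N) : posnat := exist _ n n0.

Section Counting.
Implicit Types (X Y : set posnat) (a b n : nat).

Definition nat_itv a b : set posnat := [set x | (a <= val x <= b)%N].

Definition count_in X a b : nat := #|` fset_set (X `&` nat_itv a b)|.

Lemma finite_nat_itv X a b : finite_set (X `&` nat_itv a b).
Proof.
apply: (@sub_finite_set _ _ (val @^-1` `I_b.+1)).
  by move=> x [_ /andP[_ xb]] /=.
by apply: finite_preimage => //; move=> x y _ _; exact: val_inj.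
Qed.

Lemma count_in_sub X Y a b : X `<=` Y -> (count_in X a b <= count_in Y a b)%N.
Proof.
move=> XY; apply: fsubset_leq_card; rewrite -fset_set_sub ?finite_nat_itv//.
- by apply: setSI.
- exact: finite_nat_itv.
- exact: finite_nat_itv.
Qed.

Lemma count_inU X Y a b :
  (count_in (X `|` Y) a b <= count_in X a b + count_in Y a b)%N.
Proof.
rewrite /count_in setIUl fset_setU; try exact: finite_nat_itv.
by rewrite cardfsU leq_subr.
Qed.

Lemma count_in0 a b : count_in set0 a b = 0%N.
Proof. by rewrite /count_in set0I fset_set0 cardfs0. Qed.

Lemma count_inS X a n : (a <= n.+1)%N -> count_in X a n.+1 =
  (count_in X a n + `[< exists2 x, X x & val x = n.+1 >])%N.
Proof.
move=> an; rewrite /count_in; case: asboolP => [[x Xx xn]|nX].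
  rewrite addn1 (_ : X `&` _ = x |` (X `&` nat_itv a n)).
    rewrite fset_setU1; last exact: finite_nat_itv.
    rewrite cardfsU1 in_fset_set; last exact: finite_nat_itv.
    rewrite memNset//= => -[_]; rewrite /nat_itv/= xn ltnn andbF//.
  apply/seteqP; split=> y /=; rewrite /nat_itv/=.
    move=> [Xy /andP[y0]]; rewrite leq_eqVlt => /orP[/eqP yn|yn].
      by left; apply: val_inj; rewrite /= yn -xn.
    by right; split => //; rewrite y0.
  by move=> [->|[Xy /andP[y0 yn]]]; split=> //;
    rewrite ?xn ?an ?leqnn// y0 leqW.
rewrite addn0; congr (#|` fset_set _|); apply/seteqP.
split=> y [Xy /andP[y0 yn]].
  split => //; apply/andP; split=> //.
  move: yn; rewrite leq_eqVlt => /orP[/eqP yn|//].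
  by exfalso; apply: nX; exists y.
by split=> //; apply/andP; split => //; exact: leqW.
Qed.

Lemma count_in_window X k n : (count_in X k.+1 (k + n) <= n)%N.
Proof.
elim: n => [|n IH]; last by rewrite addnS count_inS; [case: asboolP; lia|lia].
rewrite addn0 /count_in (_ : _ `&` _ = set0) ?fset_set0//.
apply/seteqP; split=> // x [_]; rewrite /nat_itv/=; lia.
Qed.

End Counting.

Lemma fin_idealU (A B : set posnat) :
  finite_set A -> finite_set B -> finite_set (A `|` B).
Proof. by rewrite finite_setU. Qed.

Lemma fin_idealS (A B : set posnat) : finite_set A -> B `<=` A -> finite_set B.
Proof. by move=> fA /sub_finite_set; apply. Qed.

Definition fin_ideal : ideal :=
  Ideal (@finite_set0 posnat) fin_idealU fin_idealS.

Section Ideals.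
Context (R : realType).
Implicit Types (X Y A B : set posnat).

Section Reciprocal.

Definition recip_summable X : Prop :=
  (\esum_(x in X) ((val x)%:R^-1 : R)%:E < +oo)%E.

Lemma esum_recip_le X Y : X `<=` Y ->
  (\esum_(x in X) ((val x)%:R^-1 : R)%:E <=
   \esum_(x in Y) ((val x)%:R^-1)%:E)%E.
Proof.
move=> XY; apply: ge_ereal_sup => _ [Z [finZ ZX] <-].
by apply: ereal_sup_ubound; exists Z => //; split => //; exact: subset_trans XY.
Qed.

Lemma recip_set0 : recip_summable set0.
Proof. by rewrite /recip_summable esum_set0. Qed.

Lemma recipS A B : recip_summable A -> B `<=` A -> recip_summable B.
Proof. by move=> Aoo BA; apply: le_lt_trans Aoo; exact: esum_recip_le. Qed.

Lemma recipU A B :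
  recip_summable A -> recip_summable B -> recip_summable (A `|` B).
Proof.
move=> Aoo Boo; rewrite /recip_summable (esumID A); last first.
  by move=> x _; rewrite lee_fin invr_ge0.
apply: lte_add_pinfty.
  by apply: le_lt_trans Aoo; apply: esum_recip_le => x [].
by apply: le_lt_trans Boo; apply: esum_recip_le => x [[]].
Qed.

Definition recip_ideal : ideal := Ideal recip_set0 recipU recipS.

End Reciprocal.

Lemma squeeze_to0 (f g : nat -> R) : (forall n, 0 <= f n <= g n) ->
  g @ \oo --> 0 -> f @ \oo --> 0.
Proof.
move=> fg g0; apply: (@squeeze_cvgr _ _ _ _ (cst 0) g f) => //.
  exact: nearW.
exact: cvg_cst.
Qed.

Lemma squeezeD_to0 (f g h : nat -> R) : (forall n, 0 <= f n <= g n + h n) ->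
  g @ \oo --> 0 -> h @ \oo --> 0 -> f @ \oo --> 0.
Proof.
move=> fgh g0 h0; apply: (squeeze_to0 fgh).
by rewrite -[X in _ --> X](addr0 0); exact: cvgD.
Qed.

Definition density_seq X (n : nat) : R := (count_in X 1 n)%:R / n%:R.

(* A relation rather than a [lim], because [lim] has a junk value when the
   limit does not exist. *)
Definition has_density X (l : R) : Prop := density_seq X @ \oo --> l.

Section Density.

Lemma density_seq_ge0 X n : 0 <= density_seq X n.
Proof. by rewrite divr_ge0. Qed.

Lemma density_seq_le X Y n : X `<=` Y -> density_seq X n <= density_seq Y n.
Proof. by move=> XY; rewrite ler_wpM2r ?invr_ge0// ler_nat count_in_sub. Qed.

Lemma density_seqU X Y n :
  density_seq (X `|` Y) n <= density_seq X n + density_seq Y n.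
Proof. by rewrite -mulrDl ler_wpM2r ?invr_ge0// -natrD ler_nat count_inU. Qed.

Lemma density_set0 : has_density set0 0.
Proof.
rewrite /has_density (_ : density_seq set0 = fun=> 0); first exact: cvg_cst.
by apply/funext => n; rewrite /density_seq count_in0 mul0r.
Qed.

Lemma densityU A B :
  has_density A 0 -> has_density B 0 -> has_density (A `|` B) 0.
Proof.
by apply: squeezeD_to0 => n; rewrite density_seq_ge0 density_seqU.
Qed.

Lemma densityS A B : has_density A 0 -> B `<=` A -> has_density B 0.
Proof.
move=> A0 BA; apply: squeeze_to0 A0 => n.
by rewrite density_seq_ge0 density_seq_le.
Qed.

Definition density_ideal : ideal := @Ideal [set X | has_density X 0]
  density_set0 densityU densityS.

End Density.

(* The supremum over [k] is attained: the values are among [m / n] with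
   [m <= n]. *)
Definition window_max X (n : nat) : R :=
  sup (range (fun k : nat => (count_in X k.+1 (k + n))%:R / n%:R)).

Definition has_banach_density X (l : R) : Prop := window_max X @ \oo --> l.

Section BanachDensity.

Lemma window_max_has_sup X n :
  has_sup (range (fun k : nat => (count_in X k.+1 (k + n))%:R / n%:R : R)).
Proof.
split; first by eexists; exists 0%N.
exists (n%:R / n%:R) => _ [k _ <-].
by rewrite ler_wpM2r ?invr_ge0// ler_nat count_in_window.
Qed.

Lemma window_max_ub X n k :
  (count_in X k.+1 (k + n))%:R / n%:R <= window_max X n.
Proof. by apply: ub_le_sup; [exact: (window_max_has_sup X n).2|exists k]. Qed.

Lemma window_max_le X n M :
  (forall k, (count_in X k.+1 (k + n))%:R / n%:R <= M) -> window_max X n <= M.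
Proof.
move=> XM; apply: ge_sup; first exact: (window_max_has_sup X n).1.
by move=> _ [k _ <-].
Qed.

Lemma window_max_ge0 X n : 0 <= window_max X n.
Proof. by apply: le_trans (window_max_ub X n 0); rewrite divr_ge0. Qed.

Lemma banach_set0 : has_banach_density set0 0.
Proof.
rewrite /has_banach_density (_ : window_max set0 = fun=> 0);
  first exact: cvg_cst.
apply/funext => n; apply/eqP; rewrite eq_le window_max_ge0 andbT.
by apply: window_max_le => k; rewrite count_in0 mul0r.
Qed.

Lemma banachU A B : has_banach_density A 0 -> has_banach_density B 0 ->
  has_banach_density (A `|` B) 0.
Proof.
apply: squeezeD_to0 => n; rewrite window_max_ge0/=; apply: window_max_le => k.
apply: (@le_trans _ _ ((count_in A k.+1 (k + n))%:R / n%:R +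
                       (count_in B k.+1 (k + n))%:R / n%:R)).
  by rewrite -mulrDl ler_wpM2r ?invr_ge0// -natrD ler_nat count_inU.
by rewrite lerD ?window_max_ub.
Qed.

Lemma banachS A B :
  has_banach_density A 0 -> B `<=` A -> has_banach_density B 0.
Proof.
move=> A0 BA; apply: squeeze_to0 A0 => n.
rewrite window_max_ge0/=; apply: window_max_le => k.
apply: le_trans (window_max_ub A n k).
by rewrite ler_wpM2r ?invr_ge0// ler_nat count_in_sub.
Qed.

Definition banach_ideal : ideal := @Ideal [set X | has_banach_density X 0]
  banach_set0 banachU banachS.

End BanachDensity.

(* [A] is the union over [j] of the translates [(T + j r) + b], where [T] is a
   subset of [{0, ..., r - 1}]. Every tile has a density: see
   [tile_has_density]. *)
Definition tile : set (set posnat) := [set A | exists r b (T : set nat),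
  [/\ (0 < r)%N, (0 < b)%N, T `<=` `I_r &
      A = [set x | exists2 t, T t & exists j, val x = (t + j * r + b)%N]]].

Definition sub_mod_fin X Y : Prop := exists2 F, finite_set F & X `<=` Y `|` F.

Definition tile_densities X : set R :=
  [set l | exists A, [/\ tile A, sub_mod_fin X A & has_density A l]].

Definition tile_density X : R := inf (tile_densities X).

Section TileDensity.

Local Ltac nlia := simpl in *; lia.


Definition eventually_periodic A r b := [/\ (0 < r)%N, (0 < b)%N,
  (forall x : posnat, A x -> (b <= val x)%N) &
  forall x y : posnat, (b <= val x)%N -> val y = (val x + r)%N -> A x <-> A y].

Lemma tile_eventually_periodic A :
  tile A -> exists r b, eventually_periodic A r b.
Proof.
move=> [r [b [T [r0 b0 TI ->]]]]; exists r, b.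
split=> // [x [t _ [j ->]]|x y bx xy].
  by rewrite leq_addl.
split=> -[t Tt [j]].
  by move=> xj; exists t => //; exists j.+1; rewrite xy xj mulSn; nlia.
rewrite xy; have := TI _ Tt; rewrite /= => tr.
case: j => [|j] xj; first nlia.
by exists t => //; exists j; move: xj; rewrite mulSn; nlia.
Qed.

Lemma eventually_periodic_tile A r b : eventually_periodic A r b -> tile A.
Proof.
move=> [r0 b0 Ab Ar].
exists r, b, [set t | (t < r)%N /\ exists2 x, A x & val x = (t + b)%N].
have per j (x y : posnat) : (b <= val x)%N -> val y = (val x + j * r)%N ->
    A x <-> A y.
  elim: j y => [|j IH] y bx yx.
    by have -> : x = y by apply: val_inj; move: yx => /=; nlia.
  have z0 : (0 < val x + j * r)%N by nlia.
  pose z : posnat := mkpos z0.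
  apply: (iff_trans (IH z bx erefl)); apply: Ar => /=.
    by move: bx => /=; nlia.
  by move: yx => /=; rewrite mulSn; nlia.
split=> // [t []//|]; apply/seteqP; split=> x /=.
  move=> Ax; have bx := Ab _ Ax.
  have xE := divn_eq (val x - b) r.
  have tr := ltn_pmod (val x - b) r0.
  set q := (_ %/ r)%N in xE; set t := (_ %% r)%N in xE tr.
  have z0 : (0 < t + b)%N by nlia.
  exists t; last by exists q; move: xE bx => /=; nlia.
  split => //; exists (mkpos z0) => //.
  by apply/(per q _ x) => //=; [nlia|move: xE bx => /=; nlia].
move=> [t [tr [y Ay yt]] [j xj]].
by apply/(per j y x) => //; [exact: Ab|move: yt xj => /=; nlia].
Qed.

Lemma tile_has_density A : tile A -> exists l, has_density A l.
Proof.
move=> /tile_eventually_periodic[r [b [r0 b0 Ab Ar]]].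
pose c n := count_in A 1 n.
pose P n := `[< exists2 x, A x & val x = n >].
have cS n : c n.+1 = (c n + P n.+1)%N by exact: count_inS.
have c_le n : (c n <= n)%N by exact: (count_in_window A 0 n).
have PP n : (b <= n)%N -> P (n + r)%N = P n.
  move=> bn; apply/asboolP/asboolP => -[x Ax xn].
    have n0 : (0 < n)%N by nlia.
    by exists (mkpos n0) => //; apply/(Ar _ x).
  have n0 : (0 < n + r)%N by nlia.
  by exists (mkpos n0) => //; apply/(Ar x) => //; rewrite xn.
pose m := (c (b + r) - c b)%N.
have c_mono k l : (c k <= c (k + l))%N.
  by elim: l => [|l IH]; rewrite ?addn0// addnS cS; nlia.
have cr n : (b <= n)%N -> c (n + r)%N = (c n + m)%N.
  move=> /subnKC <-; elim: (n - b)%N => [|k IH].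
    by rewrite addn0 /m; have := c_mono b r; nlia.
  rewrite addnS addSn !cS IH -addSn PP; first by nlia.
  by nlia.
have cqr n q : (b <= n)%N -> c (n + q * r)%N = (c n + q * m)%N.
  move=> bn; elim: q => [|q IH]; first by rewrite !mul0n !addn0.
  by rewrite mulSn (addnC r) addnA cr ?IH; nlia.
have m_le : (m <= b + r)%N by rewrite /m; have := c_le (b + r)%N; nlia.
pose K := ((r + m) * (b + r))%N.
have bnd n : (b <= n)%N -> (r * c n <= n * m + K)%N /\ (n * m <= r * c n + K)%N.
  move=> bn; have nE := divn_eq (n - b) r; have sr := ltn_pmod (n - b) r0.
  set q := (_ %/ r)%N in nE; set s := (_ %% r)%N in nE sr.
  have {}nE : n = (b + s + q * r)%N by nlia.
  rewrite nE cqr; last by nlia.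
  by rewrite /K; have := c_le (b + s)%N; split; nia.
clearbody K; exists (m%:R / r%:R); apply/cvgrPdist_le => e e0; near=> n.
have bn : (b <= n)%N by near: n; exact: nbhs_infty_ge.
have Kn : K%:R / e <= n%:R by near: n; exact: nbhs_infty_ger.
have n0 : 0 < n%:R :> R by rewrite ltr0n; nlia.
have rp : 0 < r%:R :> R by rewrite ltr0n.
have r1 : 1 <= r%:R :> R by rewrite ler1n.
have [] := bnd _ bn; rewrite -!(ler_nat R) !natrD !natrM => h1 h2.
rewrite /density_seq -/(c n).
have -> : m%:R / r%:R - (c n)%:R / n%:R =
  (n%:R * m%:R - r%:R * (c n)%:R) / (r%:R * n%:R) :> R.
  by field; rewrite !lt0r_neq0.
rewrite normrM [X in _ * X]gtr0_norm ?invr_gt0 ?mulr_gt0//.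
rewrite ler_pdivrMr ?mulr_gt0//.
apply: (@le_trans _ _ K%:R).
  by rewrite ler_norml; apply/andP; split; lra.
rewrite ler_pdivrMr// in Kn; apply: (le_trans Kn).
rewrite mulrC ler_wpM2l ?(ltW e0)// ler_peMl// ltW//.
Unshelve. all: by end_near.
Qed.

Lemma tile_setU_fin A B : tile A -> tile B ->
  exists C, [/\ tile C, sub_mod_fin (A `|` B) C & C `<=` A `|` B].
Proof.
move=> /tile_eventually_periodic[r [b [r0 b0 Ab Ar]]].
move=> /tile_eventually_periodic[s [d [s0 d0 Bd Bs]]].
have per (D : set posnat) p e : (0 < e)%N ->
    (forall x y : posnat, (e <= val x)%N -> val y = (val x + p)%N ->
      D x <-> D y) ->
    forall j (x y : posnat), (e <= val x)%N -> val y = (val x + j * p)%N ->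
      D x <-> D y.
  move=> e0 Dp; elim=> [|j IH] x y bx yx.
    by have -> : x = y by apply: val_inj; move: yx => /=; nlia.
  have z0 : (0 < val x + j * p)%N by nlia.
  pose z : posnat := mkpos z0.
  apply: (iff_trans (IH x z bx erefl)); apply: Dp => /=.
    by move: bx => /=; nlia.
  by move: yx => /=; rewrite mulSn; nlia.
pose M := maxn b d.
exists ((A `|` B) `&` [set x | (M <= val x)%N]); split; last by move=> x [].
- apply: (@eventually_periodic_tile _ (s * r) M); split.
  + by rewrite muln_gt0 s0.
  + by rewrite /M; nlia.
  + by move=> x [].
  move=> x y Mx yx; have My : (M <= val y)%N by nlia.
  have Axy : A x <-> A y by apply: (per A r b b0 Ar s) => //; nlia.
  have Bxy : B x <-> B y by apply: (per B s d d0 Bs r); nlia.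
  by split=> -[+ _] => -[/Axy|/Bxy] ?; split => //; [left|right|left|right].
- exists (setT `&` nat_itv 0 M); first exact: finite_nat_itv.
  move=> x ABx; have [Mx|Mx] := leqP M (val x); [by left|right].
  by split=> //; rewrite /nat_itv/= ltnW.
Qed.

Lemma sub_mod_fin_trans X Y Z :
  sub_mod_fin X Y -> sub_mod_fin Y Z -> sub_mod_fin X Z.
Proof.
move=> [F finF XF] [G finG YG]; exists (G `|` F); first by rewrite finite_setU.
by move=> x /XF[/YG[]|] ?; [left|right; left|right; right].
Qed.

Lemma sub_mod_fin_sub X Y : X `<=` Y -> sub_mod_fin X Y.
Proof. by move=> XY; exists set0 => // x /XY; left. Qed.

Lemma sub_mod_finU X Y Z W : sub_mod_fin X Z -> sub_mod_fin Y W ->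
  sub_mod_fin (X `|` Y) (Z `|` W).
Proof.
move=> [F finF XF] [G finG YG]; exists (F `|` G); first by rewrite finite_setU.
move=> x [/XF[]|/YG[]] ?; [by left; left|by right; left| |].
  by left; right.
by right; right.
Qed.

Lemma tile_setT : tile setT.
Proof.
apply: (@eventually_periodic_tile _ 1 1); split=> // x _; exact: valP.
Qed.

Lemma tile_densities_ge0 X : lbound (tile_densities X) 0.
Proof.
move=> l [A [_ _ Al]]; apply: (cvgr_to_ge Al).
by apply: nearW => n; exact: density_seq_ge0.
Qed.

Lemma tile_densities_has_inf X : has_inf (tile_densities X).
Proof.
split; last by exists 0; exact: tile_densities_ge0.
have [l Tl] := tile_has_density tile_setT.
exists l, setT; split => //; first exact: tile_setT.
exact: sub_mod_fin_sub.
Qed.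

Lemma tile_density_ge0 X : 0 <= tile_density X.
Proof.
apply: lb_le_inf; first exact: (tile_densities_has_inf X).1.
exact: tile_densities_ge0.
Qed.

Lemma tile_density0P X : tile_density X = 0 <->
  forall e : R, 0 < e -> exists A l,
    [/\ tile A, sub_mod_fin X A, has_density A l & l < e].
Proof.
split=> [X0 e e0|Xe].
  have [l [A [tA XA Al]] le] : exists2 l, tile_densities X l & l < e.
    apply: inf_lt; first exact: (tile_densities_has_inf X).1.
    by rewrite -/(tile_density X) X0.
  by exists A, l.
apply/eqP; rewrite eq_le tile_density_ge0 andbT; apply/ler_addgt0Pr => e e0.
have [A [l [tA XA Al le]]] := Xe _ e0.
rewrite add0r; apply: le_trans (ltW le).
by apply: ge_inf; [exact: (tile_densities_has_inf X).2|exists A].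
Qed.

Lemma tile_densityS A B : tile_density A = 0 -> B `<=` A -> tile_density B = 0.
Proof.
move=> /tile_density0P A0 BA; apply/tile_density0P => e.
move=> /A0[C [l [tC AC Cl le]]].
exists C, l; split => //; apply: sub_mod_fin_trans AC.
exact: sub_mod_fin_sub.
Qed.

Lemma tile_densityU A B : tile_density A = 0 -> tile_density B = 0 ->
  tile_density (A `|` B) = 0.
Proof.
move=> /tile_density0P A0 /tile_density0P B0; apply/tile_density0P => e e0.
have e2 : 0 < e / 2 by rewrite divr_gt0.
have [C [l [tC AC Cl le]]] := A0 _ e2.
have [D [k [tD BD Dk ke]]] := B0 _ e2.
have [E [tE CDE ECD]] := tile_setU_fin tC tD.
have [m Em] := tile_has_density tE.
exists E, m; split => //.
  by apply: sub_mod_fin_trans CDE; exact: sub_mod_finU.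
apply: (@le_lt_trans _ _ (l + k)); last by lra.
apply: (ler_cvg_to Em (cvgD Cl Dk)); apply: nearW => n.
by apply: le_trans (density_seqU C D n); exact: density_seq_le.
Qed.

Lemma tile_density_set0 : tile_density set0 = 0.
Proof.
apply/tile_density0P => e e0; exists set0, 0; split => //.
- by exists 1%N, 1%N, set0; split => //; apply/seteqP; split=> // x [].
- exact: sub_mod_fin_sub.
- exact: (ideal0 density_ideal).
Qed.

Definition tile_ideal : ideal := @Ideal [set X | tile_density X = 0]
  tile_density_set0 tile_densityU tile_densityS.

End TileDensity.
End Ideals.

(* Main.v *)
Require Import Defs.
From mathcomp Require Import all_boot all_order all_algebra.
From mathcomp Require Import finmap.
From mathcomp Require Import all_classical all_reals all_analysis.
From mathcomp Require Import zify ring lra.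
Set Implicit Arguments.
Unset Strict Implicit.
Unset Printing Implicit Defensive.

Import Order.TTheory GRing.Theory Num.Theory.
Import numFieldNormedType.Exports.

Local Open Scope classical_set_scope.
Local Open Scope ring_scope.

(** Why no lifting exists.

Let [D] be a strict order in which every countable family has a strict upper
bound, and let [A_x], for [x] in [D], be sets that increase strictly modulo the
ideal [i], all contained in a set [B] whose bounded sequences belong to [X].
Suppose that [tau] is a uniformly continuous right inverse and choose [e > 0]
such that [tau] moves points at distance at most [e] by at most [1]. For a
finite list [a] of elements of [D] put [s(a) = e * sum_(x in a) 1_(A_x)] and
[f_p(a) = tau(q(s(a)))(p)] for each coordinate [p].

If [a = (x_1, ..., x_k)] and [b = (y_1, ..., y_k)] satisfy
[x_1 < y_1 < x_2 < y_2 < ...], then the corresponding sets are nested modulo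
[i], so [s(b) - s(a)] takes its values in [[0, e]] off a set of [i] and
[|f_p(a) - f_p(b)| <= 1] for every [p]. A combinatorial argument, in the spirit
of Kalton's work on maps into the space of bounded sequences, shows that this
forces every [f_p] to be almost constant, within [1] of some [c_p], for most
lists of length [k], and countably many coordinates can be treated at the same
time ([interlaced_stabilize]). Hence there are lists [a] and [b] of length [k],
with all of [a] below all of [b], such that [|f_p(a) - f_p(b)| <= 2] for all
[p]. But [q] of the difference of the two lifts is [q(s(b) - s(a))], and
[s(b) - s(a)] equals [e * k] on a set that is not in [i]. For [k] large this is
absurd ([no_uc_right_inverse_of_tower]).

Such towers are obtained from a sequence of disjoint blocks [Q_k], each in [i],
of which no infinite subfamily has its union in [i]: index the blocks by pairs
[(m, l)] and associate with a function [g] the union of the blocks with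
[l < g m]. Functions ordered by eventual domination form a countably directed
order ([no_uc_right_inverse_of_blocks]).

It remains to choose blocks whose total union lies in the ideal that defines
[X]; five choices serve for all the pairs. Single points, quickly growing and
highly divisible by two, treat the ideal of finite sets; quickly growing points
that meet all the residue classes treat tile density; quickly growing intervals,
one of each length, treat Banach density; long stretches of the multiples of
[2 ^ k], with reciprocal sum at least [1], treat reciprocal sums; the dyadic
intervals treat density. *)

(** * Most lists over a countably directed order *)

Definition countably_directed (D : Type) (lt : D -> D -> Prop) :=
  forall g : nat -> D, exists h, forall n, lt (g n) h.

Section Eventually.
Context (D : Type) (lt : D -> D -> Prop).
Context (lt_trans : forall x y z, lt x y -> lt y z -> lt x z).
Context (lt_directed : countably_directed lt).
Implicit Types (k : nat) (P Q : seq D -> Prop) (x y z : D) (a b l : seq D).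

(** The quantifier [exists x, forall y > x] iterated [k] times. It is not the
same as quantifying over all lists with entries beyond one threshold: each
threshold may depend on the entries already chosen, and this freedom is what
makes the negation playable in [frequently_interlaced]. *)
Fixpoint ultimately k P : Prop :=
  if k is k'.+1 then
    exists x, forall y, lt x y -> ultimately k' (fun l => P (y :: l))
  else P [::].

Lemma ultimately_mono k P Q : (forall l, P l -> Q l) ->
  ultimately k P -> ultimately k Q.
Proof.
elim: k P Q => [|k IH] P Q PQ /=; first exact: PQ.
by move=> [x Px]; exists x => y /Px; apply: IH => l; exact: PQ.
Qed.

Lemma ultimately_all (x0 : D) k P : (forall l, size l = k -> P l) ->
  ultimately k P.
Proof.
elim: k P => [|k IH] P Pk /=; first exact: Pk.
by exists x0 => y _; apply: IH => l lk; apply: Pk; rewrite /= lk.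
Qed.

(** At each of the [k] stages the countably many thresholds have a common upper
bound. This is the only place where countability of the set of coordinates
matters; it excludes orders with a countable cofinal subset, such as that of the
real numbers. *)
Lemma ultimately_countable k (P : nat -> seq D -> Prop) :
  (forall n, ultimately k (P n)) -> ultimately k (fun l => forall n, P n l).
Proof.
elim: k P => [//|k IH] P /= /choice[g gP].
have [h gh] := lt_directed g.
by exists h => y hy; apply: IH => n; apply: gP; exact: lt_trans hy.
Qed.

Lemma ultimately_and k P Q : ultimately k P -> ultimately k Q ->
  ultimately k (fun l => P l /\ Q l).
Proof.
move=> Pk Qk.
have /ultimately_countable : forall n, ultimately k (if n is 0%N then P else Q).
  by case.
by apply: ultimately_mono => l PQ; split; [exact: (PQ 0%N)|exact: (PQ 1%N)].
Qed.

Lemma lt_ub2 x y : exists z, lt x z /\ lt y z.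
Proof.
have [z xyz] := lt_directed (fun n => if n is 0%N then x else y).
by exists z; split; [exact: (xyz 0%N)|exact: (xyz 1%N)].
Qed.

Lemma ultimately_ex x k P : ultimately k P ->
  exists l, [/\ size l = k, List.Forall (lt x) l & P l].
Proof.
elim: k P => [|k IH] P /=; first by exists [::]; split.
move=> [z zP]; have [y [xy zy]] := lt_ub2 x z.
have [l [lk xl Pl]] := IH _ (zP _ zy).
by exists (y :: l); split; rewrite /= ?lk//; constructor.
Qed.

(** The metric idea: for sums over two such lists, of whatever length, the terms
cancel in pairs and leave the weight of a single set. *)
Inductive interlaced : D -> seq D -> seq D -> Prop :=
| interlaced_nil x : interlaced x [::] [::]
| interlaced_cons x y z a b : lt x y -> lt y z -> interlaced z a b ->
    interlaced x (y :: a) (z :: b).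

(** Since neither negated property is ultimate, after any threshold there is a
good next entry for the first list, and, beyond it, a good next entry for the
second one: the two lists can be grown in turn. *)
Lemma frequently_interlaced x k P Q :
  ~ ultimately k (fun l => ~ P l) -> ~ ultimately k (fun l => ~ Q l) ->
  exists a b, [/\ size a = k, size b = k, interlaced x a b, P a & Q b].
Proof.
elim: k x P Q => [|k IH] x P Q /=.
  move=> /contrapT P0 /contrapT Q0.
  by exists [::], [::]; split => //; constructor.
move=> /forallNP/(_ x)/existsNP[y /not_implyP[xy yP]].
move=> /forallNP/(_ y)/existsNP[z /not_implyP[yz zQ]].
have [a [b [ak bk zab Pa Qb]]] := IH z _ _ yP zQ.
by exists (y :: a), (z :: b); split; rewrite /= ?ak ?bk//; constructor.
Qed.

Section Stabilize.
Context (R : realType) (x0 : D) (k : nat) (M : R).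

(** Let [u] be the ultimate upper bound of [f]. Values near [u] recur, so values
below [u - 3 / 2] cannot: otherwise two interlaced lists would have values that
are more than [1] apart. So [f] ultimately lies in an interval of length [2]. *)
Lemma interlaced_almost_constant (f : seq D -> R) :
  (forall l, size l = k -> `|f l| <= M) ->
  (forall x a b, size a = k -> size b = k -> interlaced x a b ->
     `|f a - f b| <= 1) ->
  exists c, ultimately k (fun l => `|f l - c| <= 1).
Proof.
move=> fM flip.
pose U := [set u | ultimately k (fun l => f l <= u)].
have UM : U M.
  by apply: (ultimately_all x0) => l /fM; rewrite ler_norml => /andP[].
have U_lb : lbound U (- M).
  move=> u /(ultimately_ex x0)[l [lk _ lu]]; apply: le_trans lu.
  by have := fM _ lk; rewrite ler_norml => /andP[].
have infU : has_inf U by split; [exists M|exists (- M)].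
pose u := inf U.
have up : ultimately k (fun l => f l <= u + 2^-1).
  have [v Uv vu] : exists2 v, U v & v < u + 2^-1.
    by apply: inf_lt; [exact: infU.1|rewrite ltrDl invr_gt0].
  by apply: ultimately_mono Uv => l /le_trans; apply; exact: ltW.
have down : ultimately k (fun l => u - 2^-1 - 1 <= f l).
  apply: contrapT => nd.
  have nu : ~ ultimately k (fun l => ~ (u - 2^-1 < f l)).
    move=> H; have : U (u - 2^-1).
      by apply: ultimately_mono H => l /negP; rewrite -leNgt.
    move=> /(ge_inf infU.2); rewrite -/u; lra.
  have nd' : ~ ultimately k (fun l => ~ (f l < u - 2^-1 - 1)).
    move=> H; apply: nd; apply: ultimately_mono H => l /negP.
    by rewrite -leNgt.
  have [a [b [ak bk ab ua ub]]] := frequently_interlaced x0 nu nd'.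
  have := flip _ _ _ ak bk ab; rewrite ler_norml => /andP[]; lra.
exists (u - 2^-1); apply: ultimately_mono (ultimately_and up down) => l.
move=> [ul dl]; rewrite ler_norml; apply/andP; split; lra.
Qed.

Lemma interlaced_stabilize (f : nat -> seq D -> R) :
  (forall n l, size l = k -> `|f n l| <= M) ->
  (forall n x a b, size a = k -> size b = k -> interlaced x a b ->
     `|f n a - f n b| <= 1) ->
  exists c, ultimately k (fun l => forall n, `|f n l - c n| <= 1).
Proof.
move=> fM flip.
have /choice[c fc] : forall n, exists c,
    ultimately k (fun l => `|f n l - c| <= 1).
  by move=> n; apply: interlaced_almost_constant; [exact: fM|exact: flip].
by exists c; exact: ultimately_countable.
Qed.

End Stabilize.
End Eventually.

(** * Lifting through a quotient of a space of bounded sequences *)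

Lemma unif_continuous_modulus (R : realType) (U V : normedModType R)
    (f : U -> V) : unif_continuous f ->
  exists2 e : R, 0 < e & forall x y, `|x - y| <= e -> `|f x - f y| <= 1.
Proof.
move=> fuc.
have ent1 : entourage [set xy : V * V | ball xy.1 1 xy.2].
  exact: (entourage_ball V 1%:pos).
have : entourage ((fun xy => (f xy.1, f xy.2)) @^-1`
    [set xy : V * V | ball xy.1 1 xy.2]) := fuc _ ent1.
rewrite -entourage_ballE => -[e /= e0 fe].
exists (e / 2); first by rewrite divr_gt0.
move=> x y xy; apply: ltW.
have : ball (f x) 1 (f y); last by rewrite -ball_normE.
apply: (fe (x, y)); rewrite -ball_normE /ball_ /=.
by apply: le_lt_trans xy _; lra.
Qed.

Lemma bounded_linfty (R : realType) (u : posnat -> R) (M : R) :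
  (forall p, `|u p| <= M) -> exists2 v : linfty R, v =1 u & `|v| <= M.
Proof.
move=> uM; have bu : u \in @linfty_pred R by apply/linfty_predP; exists M.
by exists (Linfty bu) => //; exact: sup_norm_le.
Qed.

Lemma linftyD (R : realType) (u v : linfty R) p : (u + v) p = u p + v p.
Proof. by []. Qed.

Lemma linftyB (R : realType) (u v : linfty R) p : (u - v) p = u p - v p.
Proof. by []. Qed.

(** [ev] presents the normed space [V] as a space of bounded sequences that
contains all those supported in [B]; [E] consists of those that converge to [0]
along [i]. *)
Section Lifting.
Context (R : realType) (V : normedModType R) (E : closedSubspace V) (i : ideal).
Context (ev : {linear V -> linfty R}) (B : set posnat).
Context (ev_norm : forall v, `|ev v| = `|v|).
Context (evE : forall v, E v <-> ic0 R i (ev v)).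
Context (ev_onto : forall u : linfty R,
  (forall p, ~ B p -> u p = 0) -> exists v, ev v = u).

(** Values on a set of the ideal do not affect the class: they can be replaced
by [0], which leaves a representative of norm at most [e]. *)
Lemma quotient_map_norm_le (e : R) v (S : set posnat) : i S -> 0 <= e ->
  (forall p, ~ B p -> ev v p = 0) -> (forall p, ~ S p -> `|ev v p| <= e) ->
  `|quotient_map E v| <= e.
Proof.
move=> iS e0 vB ve.
have [u uE ue] : exists2 u : linfty R,
    u =1 (fun p => if `|ev v p| <= e then ev v p else 0) & `|u| <= e.
  by apply: bounded_linfty => p; case: ifP => // _; rewrite normr0.
have [p /vB vp|v' v'u] := ev_onto (u := u).
  by rewrite uE vp; case: ifP.
have -> : quotient_map E v = quotient_map E v'.
  apply/quotient_mapP/evE => d d0; apply: (idealS iS) => p /=.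
  rewrite linearB linftyB v'u uE subr0; case: ifP => [_|/negP vp].
    by rewrite subrr normr0 leNgt d0.
  by move=> _; apply: contrapT => /ve.
by apply: le_trans (quotient_norm_le _ _) _; rewrite -ev_norm v'u.
Qed.

Lemma quotient_mapB v w :
  quotient_map E v - quotient_map E w = quotient_map E (v - w).
Proof. by apply/eqP; rewrite subr_eq -quotient_mapD subrK. Qed.

Context (D : Type) (lt : D -> D -> Prop) (x0 : D) (A : D -> set posnat).
Context (lt_trans : forall x y z, lt x y -> lt y z -> lt x z).
Context (lt_directed : countably_directed lt).
Context (AB : forall x, A x `<=` B).
Context (A_le : forall x y, lt x y -> i (A x `\` A y)).
Context (A_lt : forall x y, lt x y -> ~ i (A y `\` A x)).

Definition multiplicity (l : seq D) p : R := \sum_(x <- l) (p \in A x)%:R.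

Lemma multiplicity_nil p : multiplicity [::] p = 0.
Proof. by rewrite /multiplicity big_nil. Qed.

Lemma multiplicity_cons x l p :
  multiplicity (x :: l) p = (p \in A x)%:R + multiplicity l p.
Proof. by rewrite /multiplicity big_cons. Qed.

(** Off a set of [i] the sets of the two lists form one chain [A_x, A_y1, A_z1,
A_y2, ...] of inclusions, so that the number of sets that contain [p] is the
same in both lists, or larger by one in the second. The bound by [1 - 1_(A_x)]
makes the induction work: once [p] is in a set of the chain, it lies in all the
later ones and the difference vanishes. *)
Lemma multiplicity_interlaced x a b : interlaced lt x a b ->
  exists2 S, i S & forall p, ~ S p ->
    0 <= multiplicity b p - multiplicity a p <= 1 - (p \in A x)%:R.
Proof.
elim=> {x a b} [x|x y z a b xy yz _ [S iS Sab]].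
  exists set0; first exact: ideal0.
  by move=> p _; rewrite subrr lexx /=; case: (p \in A x); rewrite /=; lra.
exists (S `|` (A x `\` A y) `|` (A y `\` A z)).
  by apply: idealU; [apply: idealU|]; [|exact: A_le|exact: A_le].
move=> p /not_orP[/not_orP[/Sab + pxy] pyz]; rewrite !multiplicity_cons.
have {pxy} pxy : p \in A x -> p \in A y.
  by rewrite !in_setE => px; apply: contrapT => py; apply: pxy.
have {pyz} pyz : p \in A y -> p \in A z.
  by rewrite !in_setE => px; apply: contrapT => py; apply: pyz.
move: pxy pyz; case: (p \in A x); case: (p \in A y); case: (p \in A z) => //=;
  (try by move=> /(_ isT)); (try by move=> _ /(_ isT)) => _ _ /andP[? ?];
  apply/andP; split; lra.
Qed.

(** Each entry of the list contributes [1] on [A x], off a set of [i]: the sets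
increase modulo [i]. *)
Lemma multiplicity_full x l : List.Forall (lt x) l ->
  exists2 S, i S & forall p, ~ S p -> A x p -> multiplicity l p = (size l)%:R.
Proof.
elim=> {l} [|y l xy _ [S iS Sl]].
  by exists set0; [exact: ideal0|move=> p _ _; rewrite multiplicity_nil].
exists (S `|` (A x `\` A y)); first by apply: idealU => //; exact: A_le.
move=> p /not_orP[Sp xyp] xp.
rewrite multiplicity_cons Sl// mem_set; last first.
  by apply: contrapT => yp; apply: xyp.
by rewrite addrC natr1.
Qed.

(** Dually, each entry contributes [0] off [A x] and a set of [i]. *)
Lemma multiplicity_empty x l : List.Forall (fun y => lt y x) l ->
  exists2 S, i S & forall p, ~ S p -> ~ A x p -> multiplicity l p = 0.
Proof.
elim=> {l} [|y l yx _ [S iS Sl]].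
  by exists set0; [exact: ideal0|move=> p _ _; rewrite multiplicity_nil].
exists (S `|` (A y `\` A x)); first by apply: idealU => //; exact: A_le.
move=> p /not_orP[Sp yxp] xp; rewrite multiplicity_cons Sl// memNset ?add0r//.
by move=> yp; apply: yxp.
Qed.

Lemma Forall_ub (l : seq D) : exists x, List.Forall (fun y => lt y x) l.
Proof.
have [x xl] := lt_directed (nth x0 l); exists x.
have : forall n, (n < size l)%N -> lt (nth x0 l n) x by [].
elim: l {xl} => [|y l IH] xl; constructor; first exact: (xl 0%N).
by apply: IH => n nl; exact: (xl n.+1).
Qed.

(** The lifts of the sums over two lists of length [k], one far above the other,
differ by at most [2] in each coordinate because they are almost constant in the
sense of [interlaced_stabilize], yet they must differ by nearly [e * k >= 3] on
a set outside the ideal. *)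
Theorem no_uc_right_inverse_of_tower : ~ has_uc_right_inverse E.
Proof.
move=> [tau /unif_continuous_modulus[e e0 tau_e] tauK].
have /choice[w wE] : forall x, exists v, forall p,
    ev v p = e * (p \in A x)%:R.
  move=> x; have [u uE _] : exists2 u : linfty R,
      u =1 (fun p => e * (p \in A x)%:R) & `|u| <= e.
    apply: bounded_linfty => p; case: (p \in A x); rewrite ?mulr1 ?mulr0.
      by rewrite gtr0_norm.
    by rewrite normr0 ltW.
  have [p Bp|v vu] := ev_onto (u := u).
    by rewrite uE memNset ?mulr0// => /AB.
  by exists v => p; rewrite vu uE.
pose s l : V := \sum_(x <- l) w x.
have sE l p : ev (s l) p = e * multiplicity l p.
  rewrite /s; elim: l => [|x l IH].
    by rewrite big_nil linear0 multiplicity_nil mulr0.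
  by rewrite big_cons linearD linftyD IH wE multiplicity_cons mulrDr.
have mB l p : ~ B p -> multiplicity l p = 0.
  move=> Bp; rewrite /multiplicity big1// => x _.
  by rewrite memNset// => /AB.
pose f l := ev (tau (quotient_map E (s l))).
have f_near v v' : `|quotient_map E v - quotient_map E v'| <= e ->
    `|ev (tau (quotient_map E v)) - ev (tau (quotient_map E v'))| <= 1.
  by move=> /tau_e; rewrite -linearB ev_norm.
have f_near_p a b p : `|quotient_map E (s a) - quotient_map E (s b)| <= e ->
    `|f a p - f b p| <= 1.
  by move=> /f_near; exact: (le_trans (sup_norm_ub (f a - f b) p)).
pose C := `|f [::]|.
(* Adding one set to the list moves the class by at most [e], so its lift moves
   by at most [1]. *)
have f_bound l : `|f l| <= C + (size l)%:R.
  elim: l => [|x l IH]; first by rewrite addr0.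
  rewrite -(subrK (f l) (f (x :: l))); apply: le_trans (ler_normD _ _) _.
  rewrite /= -natr1 addrA addrC; apply: lerD => //; apply: f_near.
  rewrite quotient_mapB; apply: (@quotient_map_norm_le _ _ set0).
  - exact: ideal0.
  - exact: ltW.
  - move=> p Bp; rewrite linearB linftyB.
    by rewrite !sE !mB// mulr0 subr0.
  - move=> p _; rewrite linearB linftyB !sE -mulrBr multiplicity_cons addrK.
    by case: (p \in A x); rewrite ?mulr1 ?mulr0 ?normr0 ?gtr0_norm// ltW.
have [k ek] : exists k : nat, 3 <= e * k%:R.
  exists (Num.trunc (3 / e)).+1; rewrite mulrC -ler_pdivrMr// ltW//.
  exact: truncnS_gt.
(* The coordinates, which start at [1], are numbered from [0]. *)
pose g n l := f l (mkpos (ltn0Sn n)).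
have [c cP] : exists c,
    ultimately lt k (fun l => forall n, `|g n l - c n| <= 1).
  apply: (interlaced_stabilize lt_trans lt_directed x0 (M := C + k%:R)).
    move=> n l lk; apply: le_trans (sup_norm_ub _ _) _.
    by rewrite -lk; exact: f_bound.
  move=> n x a b ak bk ab; apply: f_near_p.
  have [S iS Sab] := multiplicity_interlaced ab.
  rewrite quotient_mapB; apply: (@quotient_map_norm_le _ _ S) => //.
  - exact: ltW.
  - move=> p Bp; rewrite linearB linftyB.
    by rewrite !sE !mB// mulr0 subr0.
  - move=> p /Sab/andP[ab0 ab1]; rewrite linearB linftyB !sE -mulrBr normrM.
    rewrite gtr0_norm// ger_pMr// ler_norml; apply/andP; split; last by lra.
    have : 0 <= (p \in A x)%:R :> R by [].
    lra.
have [a [ak _ aP]] := ultimately_ex lt_directed x0 cP.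
have [x xa] := Forall_ub a.
have [y xy] := lt_directed (fun=> x).
have [b [bk yb bP]] := ultimately_ex lt_directed y cP.
have fab p : `|f b p - f a p| <= 2.
  have -> : p = mkpos (ltn0Sn (val p).-1).
    by apply: val_inj; rewrite /= prednK//; exact: (valP p).
  have := aP (val p).-1; have := bP (val p).-1; rewrite /g.
  rewrite !ler_norml => /andP[? ?] /andP[? ?]; apply/andP; split; lra.
have [S iS Sb] := multiplicity_full yb.
have [T iT Ta] := multiplicity_empty xa.
have Eab : E (tau (quotient_map E (s b)) - tau (quotient_map E (s a))
              - (s b - s a)).
  by apply/quotient_mapP; rewrite -!quotient_mapB !tauK.
(* Off [S] and [T], the set [A y] without [A x] lies where the difference of the
   lifts and the difference of the sums are at least [1] apart, and that happens
   only on a set of the ideal. *)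
apply: (A_lt (xy 0%N)).
apply: (idealS (idealU (idealU iS iT) (iffLR (evE _) Eab _ (ltr01)))).
move=> p [yp xp].
have [|Sp] := pselect (S p); first by left; left.
have [|Tp] := pselect (T p); first by left; right.
right; rewrite /= subr0 !(linearB ev) !linftyB !sE Sb// Ta// bk mulr0 subr0.
rewrite -/(f b) -/(f a).
have := fab p; rewrite ler_norml => /andP[_ f2].
by rewrite ler_normr; apply/orP; right; lra.
Qed.

End Lifting.

(** * Towers from blocks *)

Definition eventually_lt (g h : nat -> nat) :=
  exists M, forall m, (M <= m)%N -> (g m < h m)%N.

Lemma eventually_lt_trans g h k :
  eventually_lt g h -> eventually_lt h k -> eventually_lt g k.
Proof.
move=> [M gh] [N hk]; exists (maxn M N) => m; rewrite geq_max => /andP[Mm Nm].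
exact: ltn_trans (gh _ Mm) (hk _ Nm).
Qed.

(** Diagonal argument: the witness dominates at [m] the first [m + 1]
functions. *)
Lemma eventually_lt_directed : countably_directed eventually_lt.
Proof.
move=> g; exists (fun m => (\max_(n < m.+1) g n m).+1) => n; exists n => m nm.
rewrite ltnS; pose n' : 'I_m.+1 := Ordinal (nm : (n < m.+1)%N).
exact: (leq_bigmax (F := fun n : 'I_m.+1 => g n m) n').
Qed.

Definition unbounded (K : set nat) := forall N, exists2 k, K k & (N <= k)%N.

(** An injective function takes only finitely many of its values below [N]. *)
Lemma unbounded_image (f : nat -> nat) M : injective f ->
  unbounded [set f m | m in [set m | (M <= m)%N]].
Proof.
move=> f_inj N; apply: contrapT => fN; apply: infinite_nat.
have fin : finite_set (f @^-1` `I_N `|` `I_M).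
  rewrite finite_setU; split=> //.
  by apply: finite_preimage => // x y _ _; exact: f_inj.
apply: sub_finite_set fin => m _.
have [Mm|mM] := leqP M m; [left|by right].
rewrite /= ltnNge; apply/negP => Nm; apply: fN.
by exists (f m) => //; exists m.
Qed.

Lemma ideal_bigcup_lt (i : ideal) (F : nat -> set posnat) n :
  (forall k, i (F k)) -> i (\bigcup_(k in `I_n) F k).
Proof.
move=> iF; elim: n => [|n IH]; first by rewrite II0 bigcup_set0; exact: ideal0.
by rewrite IIS bigcup_setU bigcup_set1; apply: idealU.
Qed.

(** In the quotient of the power set by [i], each block vanishes but the union
of infinitely many of them does not. *)
Definition positive_blocks (i : ideal) (Q : nat -> set posnat) :=
  [/\ forall k l p, Q k p -> Q l p -> k = l, forall k, i (Q k) &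
      forall K, unbounded K -> ~ i (\bigcup_(k in K) Q k)].

Section Blocks.
Context (i : ideal) (Q : nat -> set posnat) (iQ : positive_blocks i Q).

(** The region under the graph of [g], in a grid whose cells are the blocks. *)
Definition block_tower (g : nat -> nat) : set posnat :=
  \bigcup_m \bigcup_(l in `I_(g m)) Q (choice.pickle (m, l)).

(** If [h] eventually dominates [g], only finitely many columns, hence finitely
many cells, stick out. *)
Lemma block_tower_le g h :
  eventually_lt g h -> i (block_tower g `\` block_tower h).
Proof.
have [_ Qi _] := iQ; move=> [M gh].
apply: (@idealS _ (\bigcup_(m in `I_M) \bigcup_(l in `I_(g m))
    Q (choice.pickle (m, l)))).
  by do 2! apply: ideal_bigcup_lt => ?.
move=> p [[m _ [l lg Qp]] hp]; exists m; last by exists l.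
rewrite /= ltnNge; apply/negP => Mm; apply: hp; exists m => //; exists l => //=.
exact: ltn_trans lg (gh _ Mm).
Qed.

(** In each of almost all columns [m], the cell [(m, g m)] lies under the graph
of [h] but not under that of [g]. *)
Lemma block_tower_lt g h :
  eventually_lt g h -> ~ i (block_tower h `\` block_tower g).
Proof.
have [Qdisj _ QK] := iQ; move=> [M gh] ihg.
pose f m := choice.pickle (m, g m).
have f_inj : injective f by move=> m n /(pcan_inj choice.pickleK)[].
apply: (QK _ (unbounded_image M f_inj)); apply: (idealS ihg).
move=> p [_ [m /= Mm <-] Qp]; split.
  by exists m => //; exists (g m) => //=; exact: gh.
move=> [n _ [l /= lg Qp']].
have [mn gl] := pcan_inj choice.pickleK (Qdisj _ _ _ Qp Qp').
by move: lg; rewrite -gl mn ltnn.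
Qed.

Section NoLifting.
Context (R : realType).

Lemma no_uc_right_inverse_of_blocks (V : normedModType R)
    (E : closedSubspace V) (ev : {linear V -> linfty R}) :
  (forall v, `|ev v| = `|v|) -> (forall v, E v <-> ic0 R i (ev v)) ->
  (forall u : linfty R, (forall p, ~ (\bigcup_k Q k) p -> u p = 0) ->
    exists v, ev v = u) ->
  ~ has_uc_right_inverse E.
Proof.
move=> ev_norm evE ev_onto.
apply: (no_uc_right_inverse_of_tower ev_norm evE ev_onto (fun=> 0%N)
  (A := block_tower) eventually_lt_trans eventually_lt_directed).
- by move=> g p [m _ [l _ Qp]]; exists (choice.pickle (m, l)).
- exact: block_tower_le.
- exact: block_tower_lt.
Qed.

Lemma no_uc_right_inverse_linfty : ~ has_uc_right_inverse (ic0 R i).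
Proof.
apply: (@no_uc_right_inverse_of_blocks _ _ idfun) => // u _.
by exists u.
Qed.

(** A bounded sequence supported in a set of [j] converges to [0] along [j]. *)
Lemma no_uc_right_inverse_trace (j : ideal) : j (\bigcup_k Q k) ->
  ~ has_uc_right_inverse (trace_subspace (ic0 R j) (ic0 R i)).
Proof.
move=> jQ.
apply: (@no_uc_right_inverse_of_blocks _ _
  (\val : {linear subspace_type (ic0 R j) -> linfty R})) => // u uQ.
have uj : u \in in_subspace (ic0 R j).
  apply/in_subspaceP => e e0; apply: (idealS jQ) => p /=; rewrite subr0.
  by apply: contraPP => /uQ ->; rewrite normr0 leNgt e0.
by exists (SubspaceType uj).
Qed.

End NoLifting.
End Blocks.

(** * Counting, sparse sets and sets with many divisors *)

Lemma finite_posnat_lt (S : set posnat) : finite_set S ->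
  exists N, forall p, S p -> (val p < N)%N.
Proof.
move=> finS; exists (\max_(p <- fset_set S) val p)%N.+1 => p Sp.
rewrite ltnS; apply: (leq_bigmax_seq (F := fun p : posnat => val p)) => //.
by rewrite in_fset_set// mem_set.
Qed.

Lemma finite_lt_posnat (S : set posnat) N :
  (forall p, S p -> (val p < N)%N) -> finite_set S.
Proof.
move=> SN; apply: (@sub_finite_set _ _ (val @^-1` `I_N)); first exact: SN.
by apply: finite_preimage => // p q _ _; exact: val_inj.
Qed.

Lemma count_in_leq_inj (X : set posnat) a b (f : posnat -> nat) c :
  (forall p, X p -> (a <= val p <= b)%N -> (f p < c)%N) ->
  (forall p q, X p -> X q -> (a <= val p)%N -> (val p < val q)%N ->
     (val q <= b)%N -> f p <> f q) ->
  (count_in X a b <= c)%N.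
Proof.
move=> fc f_inj; rewrite /count_in.
set F := fset_set _.
have FP p : p \in F -> X p /\ (a <= val p <= b)%N.
  by rewrite in_fset_set; [rewrite inE => -[]|exact: finite_nat_itv].
have Fu : uniq [seq f p | p <- F].
  rewrite map_inj_in_uniq ?fset_uniq// => p q /FP[Xp /andP[ap pb]].
  move=> /FP[Xq /andP[aq qb]] fpq; apply: val_inj => /=.
  have [pq|qp|//] := ltngtP (val p) (val q).
  - by exfalso; exact: (f_inj p q).
  - by exfalso; exact: (f_inj q p).
rewrite -(size_iota 0 c) -(size_map f); apply: uniq_leq_size => // n.
by move=> /mapP[p /FP[Xp pab] ->]; rewrite mem_iota /= fc.
Qed.

Lemma count_in_lt (X : set posnat) N a b :
  (forall p, X p -> (val p < N)%N) -> (count_in X a b <= N)%N.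
Proof.
move=> XN; apply: (count_in_leq_inj (f := val)) => [p Xp _|p q _ _ _ pq _].
  exact: XN.
by move: pq => /[swap] ->; rewrite ltnn.
Qed.

(** Divide the window into intervals of length [m]; each contains at most one
point. *)
Lemma count_in_gaps (X : set posnat) m k n : (0 < m)%N ->
  (forall p q, X p -> X q -> (val p < val q)%N -> (val p + m <= val q)%N) ->
  (count_in X k.+1 (k + n) <= (n %/ m).+1)%N.
Proof.
move=> m0 Xm.
apply: (count_in_leq_inj (f := fun p => ((val p - k.+1) %/ m)%N)).
  move=> p _ /andP[kp pn]; rewrite ltnS; apply: leq_div2r; lia.
move=> p q Xp Xq kp pq _; have := Xm _ _ Xp Xq pq => pmq fpq.
have := leq_div2r m (_ : (val p - k.+1 + m <= val q - k.+1)%N).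
by rewrite divnDr// divnn m0 -fpq; lia.
Qed.

Lemma count_in_full (X : set posnat) k n :
  (forall p, (k < val p <= k + n)%N -> X p) -> count_in X k.+1 (k + n) = n.
Proof.
elim: n => [|n IH] Xkn.
  by apply/eqP; rewrite -leqn0; exact: count_in_window.
rewrite addnS count_inS; last by lia.
rewrite IH; last by move=> p /andP[kp pn]; apply: Xkn; lia.
case: asboolP => [_|[]]; first by rewrite addn1.
by exists (mkpos (ltn0Sn (k + n))) => //; apply: Xkn => /=; lia.
Qed.

Lemma count_in_suffix (X : set posnat) a b :
  (count_in X a b <= count_in X 1 b)%N.
Proof.
apply: fsubset_leq_card; rewrite -fset_set_sub; try exact: finite_nat_itv.
move=> p [Xp /andP[_ pb]]; split=> //; apply/andP; split => //.
exact: (valP p).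
Qed.

Section Ideals.
Context (R : realType).
Implicit Types X Y : set posnat.

Lemma natSinv_le (e : R) : 0 < e -> exists2 m, (0 < m)%N & (m%:R^-1 : R) <= e.
Proof.
move=> e0; exists (Num.trunc e^-1).+1 => //.
by rewrite invf_ple ?posrE//; exact/ltW/truncnS_gt.
Qed.

Lemma banach_le_density X : banach_ideal R X -> density_ideal R X.
Proof.
apply: squeeze_to0 => n; rewrite density_seq_ge0 /=.
exact: (window_max_ub R X n 0).
Qed.

(** The gaps between consecutive elements tend to infinity. *)
Definition sparse X := forall m, exists N, forall p q, X p -> X q ->
  (N <= val p)%N -> (val p < val q)%N -> (val p + m <= val q)%N.

(** All but the first few elements are at least [m] apart, wherever the window
is. *)
Lemma count_in_sparse X m : sparse X -> (0 < m)%N ->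
  exists N, forall k n, (count_in X k.+1 (k + n) <= n %/ m + N)%N.
Proof.
move=> /(_ m)[N XN] m0; exists N.+1 => k n.
pose Y := X `&` [set p | (N <= val p)%N].
pose Z := X `&` [set p | (val p < N)%N].
have -> : X = Y `|` Z.
  rewrite -setIUr (_ : _ `|` _ = setT) ?setIT//.
  by apply/seteqP; split=> // p _ /=; exact/orP/leqVgt.
apply: leq_trans (count_inU _ _ _ _) _; rewrite addnS -addSn leq_add//.
  apply: count_in_gaps => // p q [Xp /= Np] [Xq _]; exact: XN.
by apply: count_in_lt => p [].
Qed.

Lemma sparse_banach X : sparse X -> banach_ideal R X.
Proof.
move=> sX; apply/cvgrPdist_le => e e0.
have e20 : 0 < e / 2 by rewrite divr_gt0.
have [m m0 me] := natSinv_le e20.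
have [N XN] := count_in_sparse sX m0.
near=> n; rewrite sub0r normrN ger0_norm ?window_max_ge0//.
apply: window_max_le => k.
have n0 : (0 < n)%N by near: n; exact: nbhs_infty_gt.
have Nn : N%:R / (e / 2) <= n%:R by near: n; exact: nbhs_infty_ger.
rewrite ler_pdivrMr ?ltr0n//; rewrite ler_pdivrMr// in Nn.
apply: (@le_trans _ _ (n%:R * m%:R^-1 + N%:R)).
  apply: (@le_trans _ _ (n %/ m + N)%:R); first by rewrite ler_nat.
  rewrite natrD lerD2r ler_pdivlMr ?ltr0n// -natrM ler_nat.
  exact: leq_divM.
have := ler_wpM2l (ler0n R n) me; lra.
Unshelve. all: by end_near.
Qed.

(** All but finitely many elements are divisible by [2 ^ k], for every [k]. The
powers of two suffice for tile density [0], since the densities [2^-k] of their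
multiples tend to [0]. *)
Definition dyadic_null X := forall k,
  finite_set (X `&` [set p | ~~ (2 ^ k %| val p)%N]).

Lemma dyadic_null_sparse X : dyadic_null X -> sparse X.
Proof.
move=> dX m; have [N XN] := finite_posnat_lt (dX m).
exists N => p q Xp Xq Np pq.
have dvd x : X x -> (N <= val x)%N -> (2 ^ m %| val x)%N.
  move=> Xx Nx; apply: contraTT Nx => ndvd; rewrite -ltnNge.
  by apply: XN.
have := dvdn_sub (dvd _ Xq (leq_trans Np (ltnW pq))) (dvd _ Xp Np).
rewrite -leq_subRL; last by lia.
move=> /dvdn_leq; rewrite subn_gt0 => /(_ pq); apply: leq_trans.
exact/ltnW/ltn_expl.
Qed.

Lemma dyadic_null_tile X : dyadic_null X -> tile_ideal R X.
Proof.
move=> dX; apply/tile_density0P => e e0.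
have [k k0 ke] : exists2 k, (0 < k)%N & (k%:R^-1 : R) <= e / 3.
  by apply: natSinv_le; rewrite divr_gt0.
pose A : set posnat := [set p | (2 ^ k %| val p)%N].
have k20 : (0 < 2 ^ k)%N by rewrite expn_gt0.
have tA : tile A.
  apply: (@eventually_periodic_tile _ (2 ^ k) 1); split => // [p _|p q _ pq].
    exact: (valP p).
  by rewrite /A /= -!/(val _) pq dvdn_addl.
have [l Al] := tile_has_density R tA.
exists A, l; split => //.
  exists (X `&` [set p | ~~ (2 ^ k %| val p)%N]); first exact: dX.
  move=> p Xp; have [pk|pk] := boolP (2 ^ k %| val p)%N; [by left|right].
  by split.
apply: (@le_lt_trans _ _ (2 / 3 * e)); last by lra.
apply: (cvgr_to_le Al); near=> n.
have n0 : (0 < n)%N by near: n; exact: nbhs_infty_gt.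
have kn : (k <= n)%N by near: n; exact: nbhs_infty_ge.
have An : (count_in A 1 n <= (n %/ 2 ^ k).+1)%N.
  apply: (@count_in_gaps A (2 ^ k) 0 n) => // p q /= pk qk pq.
  rewrite -leq_subRL; last by lia.
  by apply: dvdn_leq; rewrite ?subn_gt0// dvdn_sub.
rewrite /density_seq ler_pdivrMr ?ltr0n//.
apply: (@le_trans _ _ ((n %/ 2 ^ k)%:R + 1)).
  by rewrite natr1 ler_nat.
have kn1 : 1 <= k%:R^-1 * n%:R :> R.
  by rewrite mulrC ler_pdivlMr ?ltr0n// mul1r ler_nat.
have : (n %/ 2 ^ k)%:R <= k%:R^-1 * n%:R :> R.
  rewrite mulrC ler_pdivlMr ?ltr0n// -natrM ler_nat.
  apply: leq_trans (leq_divM n (2 ^ k)); rewrite leq_mul2l.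
  by apply/orP; right; exact/ltnW/ltn_expl.
have := ler_wpM2r (ler0n R n) ke; lra.
Unshelve. all: by end_near.
Qed.

Lemma finite_dyadic_null X : finite_set X -> dyadic_null X.
Proof. by move=> finX k; apply: sub_finite_set finX => p []. Qed.

End Ideals.

(** * Reciprocal sums *)

Section Recip.
Context (R : realType).
Implicit Types X : set posnat.

Definition recip_sum (s : seq posnat) : R := \sum_(p <- s) (val p)%:R^-1.

Lemma recip_sum_cat s t : recip_sum (s ++ t) = recip_sum s + recip_sum t.
Proof. by rewrite /recip_sum big_cat. Qed.

Lemma recip_sum_ge0 s : 0 <= recip_sum s.
Proof. by apply: sumr_ge0 => p _; rewrite invr_ge0. Qed.

Lemma recip_sum_uniq_sub s t : uniq s -> {subset s <= t} ->
  recip_sum s <= recip_sum t.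
Proof.
elim: s t => [|p s IH] t /=.
  by rewrite {1}/recip_sum big_nil recip_sum_ge0.
move=> /andP[ps us] st.
have pt : p \in t by apply: st; rewrite mem_head.
rewrite /recip_sum (perm_big _ (perm_to_rem pt)) !big_cons lerD2l.
apply: IH => // q qs.
have := st q; rewrite (perm_mem (perm_to_rem pt)) !inE qs orbT => /(_ isT).
by have [qp|//] := eqVneq q p; rewrite -qp qs in ps.
Qed.

Lemma recip_sum_ge s n : (forall p, p \in s -> (val p <= n)%N) ->
  (size s)%:R / n%:R <= recip_sum s.
Proof.
elim: s => [|p s IH] sn; first by rewrite /recip_sum big_nil mul0r.
rewrite /recip_sum big_cons /= -natr1 mulrDl mul1r addrC lerD//.
  have pn := sn p (mem_head _ _); have p0 := valP p.
  by rewrite lef_pV2 ?posrE ?ltr0n ?ler_nat//; exact: leq_trans pn.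
by apply: IH => q qs; apply: sn; rewrite inE qs orbT.
Qed.

(** Bounded sums over duplicate-free lists are easier to combine than a sum over
a set, because lists can be concatenated. *)
Lemma recip_idealP X : recip_ideal R X <-> exists M, forall s, uniq s ->
  (forall p, p \in s -> X p) -> recip_sum s <= M.
Proof.
split=> [|[M XM]].
  rewrite /= /recip_summable => Xoo.
  have X0 : (0 <= \esum_(x in X) ((val x)%:R^-1 : R)%:E)%E.
    by apply: esum_ge0 => p _; rewrite lee_fin invr_ge0.
  exists (fine (\esum_(x in X) ((val x)%:R^-1 : R)%:E)) => s us sX.
  rewrite -lee_fin fineK ?ge0_fin_numE//.
  apply: esum_ge; exists [set` s].
    by split=> //; exact: finite_seq.
  by rewrite -fsbig_seq// sumEFin.
rewrite /= /recip_summable; apply: (@le_lt_trans _ _ M%:E); last exact: ltry.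
apply: ge_ereal_sup => _ [F [finF FX] <-].
rewrite fsbig_finite// sumEFin lee_fin; apply: XM; first exact: fset_uniq.
by move=> p; rewrite in_fset_set// inE => /FX.
Qed.

(** Choose a finite part [s] of [X] whose reciprocal sum is almost the supremum.
The elements in [(N, n]], all beyond [s], have a small reciprocal sum, but each
contributes at least [1 / n]; so there are few of them compared with [n]. *)
Lemma recip_le_density X : recip_ideal R X -> density_ideal R X.
Proof.
move=> /recip_idealP[M XM].
pose S := [set r | exists s, [/\ uniq s, forall p, p \in s -> X p &
  r = recip_sum s]].
have supS : has_sup S.
  split; first by exists (recip_sum [::]), [::].
  by exists M => _ [s [us sX ->]]; exact: XM.
apply/cvgrPdist_le => e e0.
have e20 : 0 < e / 2 by rewrite divr_gt0.
have [_ [s [us sX ->]] sup_s] := sup_adherent e20 supS.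
have [N sN] : exists N, forall p, p \in s -> (val p <= N)%N.
  have [N sN] := finite_posnat_lt (finite_seq s).
  by exists N => p ps; exact/ltnW/sN.
near=> n; rewrite sub0r normrN ger0_norm ?density_seq_ge0//.
have n0 : (0 < n)%N by near: n; exact: nbhs_infty_gt.
have Nn : N.+1%:R / (e / 2) <= n%:R by near: n; exact: nbhs_infty_ger.
rewrite /density_seq ler_pdivrMr ?ltr0n//; rewrite ler_pdivrMr// in Nn.
pose Y := X `&` [set p | (N < val p)%N].
pose Z := X `&` [set p | (val p < N.+1)%N].
have XYZ : X = Y `|` Z.
  rewrite -setIUr (_ : _ `|` _ = setT) ?setIT//.
  by apply/seteqP; split=> // p _ /=; rewrite ltnS; exact/orP/leqVgt.
have cX : (count_in X 1 n <= count_in Y 1 n + N.+1)%N.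
  rewrite {1}XYZ; apply: leq_trans (count_inU _ _ _ _) _; rewrite leq_add2l.
  by apply: count_in_lt => p [].
pose t : seq posnat := fset_set (Y `&` nat_itv 1 n).
have tP p : p \in t -> [/\ X p, (N < val p)%N & (val p <= n)%N].
  rewrite in_fset_set; last exact: finite_nat_itv.
  by rewrite inE => -[[Xp Np] /andP[_ pn]].
have st : recip_sum (s ++ t) <= sup S.
  apply: ub_le_sup; first exact: supS.2.
  exists (s ++ t); split=> //; last first.
    by move=> p; rewrite mem_cat => /orP[/sX//|/tP[]].
  rewrite cat_uniq us fset_uniq andbT /=; apply/hasPn => p /tP[_ Np _].
  by apply: contraL Np => /sN; rewrite -leqNgt.
have tn : (count_in Y 1 n)%:R / n%:R <= recip_sum t.
  by apply: recip_sum_ge => p /tP[].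
rewrite ler_pdivrMr ?ltr0n// in tn; rewrite recip_sum_cat in st.
have te : recip_sum t <= e / 2 by lra.
have := ler_wpM2r (ler0n R n) te.
by move: cX; rewrite -(ler_nat R) natrD; lra.
Unshelve. all: by end_near.
Qed.

End Recip.

(** * Five families of blocks *)

Lemma blocks_between_disjoint (m : nat -> nat) (Q : nat -> set posnat) :
  {homo m : k l / (k <= l)%N} ->
  (forall k p, Q k p -> (m k <= val p < m k.+1)%N) ->
  forall k l p, Q k p -> Q l p -> k = l.
Proof.
move=> mm Qm k l p /Qm /andP[kp pk] /Qm /andP[lp pl].
have [kl|lk|//] := ltngtP k l.
- by have := mm _ _ kl; lia.
- by have := mm _ _ lk; lia.
Qed.

Lemma positive_blocks_sub (i i' : ideal) (Q : nat -> set posnat) :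
  (forall X, i X -> i' X) -> (forall k, i (Q k)) ->
  positive_blocks i' Q -> positive_blocks i Q.
Proof. by move=> ii' iQ [dQ _ pQ]; split => // K /pQ + /ii'. Qed.

(** Only [k + 1] values of [s]: a block that starts beyond [(k + 1) 2 ^ k] then
has a reciprocal sum of at most [2^-k], see [block_recip]. *)
Definition block (z : nat -> nat -> nat) k : set posnat :=
  [set p | exists2 s, (s <= k)%N & val p = z k s].

(** The power of two makes the reciprocal sums over blocks summable, the
factorial makes each fixed [r] divide almost all the scales. *)
Definition scale k := (2 ^ k * k.+1`!)%N.

Lemma scaleS k : scale k.+1 = (scale k * (2 * k.+2))%N.
Proof. by rewrite /scale expnS (factS k.+1); lia. Qed.

Lemma scale_ge k : (k.+1 * 2 ^ k <= scale k)%N.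
Proof. by rewrite /scale factS mulnC leq_mul2l leq_pmulr ?fact_gt0 ?orbT. Qed.

Lemma scale_gt k : (k < scale k)%N.
Proof. by apply: leq_trans (scale_ge k); rewrite leq_pmulr// expn_gt0. Qed.

Lemma scale_homo : {homo scale : k l / (k <= l)%N}.
Proof.
apply: homo_leq => [//||k]; first exact: leq_trans.
by rewrite scaleS leq_pmulr.
Qed.

Lemma dvdn_scale r k : (0 < r <= k.+1)%N -> (r %| scale k)%N.
Proof. by move=> rk; rewrite dvdn_mull// dvdn_fact. Qed.

Definition point_blocks := block (fun k _ => scale k).

(** Since each [r <= k + 1] divides [scale k], the remainder of the element of
index [s] is that of [s]; so the block meets every residue class modulo such an
[r]. The factor [s + 1] separates the elements. *)
Definition residue_blocks := block (fun k s => scale k * s.+1 + s)%N.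

Definition interval_blocks := block (fun k s => scale k + s.+1)%N.

(** The multiples of [2 ^ k] in so long a stretch that their reciprocal sum is
at least [1]: it spans [2 ^ (k + 1)] octaves, and the multiples of [2 ^ k] in an
octave contribute at least [1 / 2 ^ (k + 1)]. *)
Definition multiple_blocks k : set posnat :=
  [set p | (2 ^ k %| val p) && (2 ^ (2 ^ k.+1) < val p <= 2 ^ (2 ^ k.+2))]%N.

Definition dyadic_blocks k : set posnat :=
  [set p | (2 ^ k < val p <= 2 ^ k.+1)%N].

Lemma point_blocks_between k p : point_blocks k p ->
  (scale k <= val p < scale k.+1)%N.
Proof. by move=> [s sk ->]; have := scale_gt k; rewrite scaleS; nia. Qed.

Lemma residue_blocks_between k p : residue_blocks k p ->
  (scale k <= val p < scale k.+1)%N.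
Proof. by move=> [s sk ->]; have := scale_gt k; rewrite scaleS; nia. Qed.

Lemma interval_blocks_between k p : interval_blocks k p ->
  (scale k <= val p < scale k.+1)%N.
Proof. by move=> [s sk ->]; have := scale_gt k; rewrite scaleS; nia. Qed.

Lemma leq_expn2 a b : (a <= b)%N -> (2 ^ a <= 2 ^ b)%N.
Proof. by move=> ab; rewrite leq_exp2l. Qed.

Lemma multiple_blocks_between k p : multiple_blocks k p ->
  ((2 ^ (2 ^ k.+1)).+1 <= val p < (2 ^ (2 ^ k.+2)).+1)%N.
Proof. by rewrite ltnS => /andP[]. Qed.

Lemma dyadic_blocks_between k p : dyadic_blocks k p ->
  ((2 ^ k).+1 <= val p < (2 ^ k.+1).+1)%N.
Proof. by []. Qed.

Lemma blocks_between_finite (m : nat -> nat) (Q : nat -> set posnat) :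
  (forall k p, Q k p -> (m k <= val p < m k.+1)%N) ->
  forall k, finite_set (Q k).
Proof.
by move=> Qm k; apply: (@finite_lt_posnat _ (m k.+1)) => p /Qm /andP[].
Qed.

Lemma blocks_between_dyadic_null (m : nat -> nat) (Q : nat -> set posnat) :
  {homo m : k l / (k <= l)%N} ->
  (forall k p, Q k p -> (m k <= val p < m k.+1)%N) ->
  (forall k p, Q k p -> (2 ^ k %| val p)%N) ->
  dyadic_null (\bigcup_k Q k).
Proof.
move=> mm Qm Q2 k; apply: (@finite_lt_posnat _ (m k)) => p [[l _ Qp] /= kp].
have [lk|kl] := ltnP l k.
  by have /andP[_ pl] := Qm _ _ Qp; apply: leq_trans pl _; exact: mm.
by move: kp; rewrite (dvdn_trans _ (Q2 _ _ Qp))// dvdn_exp2l.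
Qed.

Lemma point_blocks_dyadic_null : dyadic_null (\bigcup_k point_blocks k).
Proof.
apply: blocks_between_dyadic_null scale_homo point_blocks_between _.
by move=> k p [s _ ->]; exact: dvdn_mulr.
Qed.

Lemma double_exp_homo :
  {homo (fun k => (2 ^ (2 ^ k.+1)).+1)%N : k l / (k <= l)%N}.
Proof. by move=> k l kl; rewrite ltnS !leq_expn2. Qed.

Lemma multiple_blocks_dyadic_null : dyadic_null (\bigcup_k multiple_blocks k).
Proof.
apply: blocks_between_dyadic_null double_exp_homo multiple_blocks_between _.
by move=> k p /andP[].
Qed.

(** Within the block [k] the gaps are at least [scale k], and so is the gap to
the next block. *)
Lemma residue_blocks_sparse : sparse (\bigcup_k residue_blocks k).
Proof.
move=> m; exists (scale m) => p q [k _ pk] [l _ ql] mp pq.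
have /andP[_ pk1] := residue_blocks_between pk.
have /andP[lq lq1] := residue_blocks_between ql.
have mk : (m <= k)%N.
  rewrite leqNgt; apply/negP => /scale_homo; lia.
have kl : (k <= l)%N.
  rewrite leqNgt; apply/negP => /scale_homo lk.
  by have /andP[kp _] := residue_blocks_between pk; lia.
move: pk ql => [s sk ps] [s' sk' qs]; have k_scale := scale_gt k.
have [kl'|lk|kl'] := ltngtP k l; last 1 first.
- subst l; have ss : (s < s')%N.
    rewrite ltnNge; apply/negP => s's.
    have : (scale k * s'.+1 <= scale k * s.+1)%N.
      by rewrite leq_mul2l ltnS s's orbT.
    by move: pq; rewrite ps qs; lia.
  have : (scale k * s.+2 <= scale k * s'.+1)%N.
    by rewrite leq_mul2l ltnS ss orbT.
  by rewrite ps qs mulnS; lia.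
- have := scale_homo kl'; rewrite scaleS => kl''.
  have ss : (scale k * s.+1 <= scale k * k.+1)%N.
    by rewrite leq_mul2l ltnS sk orbT.
  apply: leq_trans lq; apply: leq_trans kl''; rewrite ps mulnS.
  clear - mk sk k_scale; nia.
- by lia.
Qed.

Section Summable.
Context (R : realType).

(** The block [k] has at most [k + 1] elements, each at least [(k + 1) 2 ^ k],
so its reciprocal sum is at most [2^-k]. *)
Lemma block_recip (z : nat -> nat -> nat) :
  (forall k s, (s <= k)%N -> (scale k <= z k s)%N) ->
  recip_ideal R (\bigcup_k block z k).
Proof.
move=> zk.
pose q k : seq posnat := pmap insub [seq z k s | s <- iota 0 k.+1].
have qP k p : reflect (block z k p) (p \in q k).
  rewrite mem_pmap_sub; apply: (iffP mapP).
    by move=> [s]; rewrite mem_iota ltnS /= => sk pz; exists s.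
  by move=> [s sk pz]; exists s => //; rewrite mem_iota ltnS.
have q_sum k : recip_sum R (q k) <= 2^-1 ^+ k.
  have kk : 0 < (k.+1 * 2 ^ k)%:R :> R by rewrite ltr0n muln_gt0 expn_gt0.
  apply: (@le_trans _ _ (\sum_(p <- q k) ((k.+1 * 2 ^ k)%:R)^-1)).
    rewrite /recip_sum big_seq [leRHS]big_seq; apply: ler_sum => p /qP[s sk pz].
    have zp : (k.+1 * 2 ^ k <= val p)%N.
      by rewrite pz; exact: leq_trans (scale_ge k) (zk _ _ sk).
    by rewrite lef_pV2 ?posrE// ?ler_nat// ltr0n; exact: (valP p).
  rewrite big_const_seq count_predT iter_addr_0 -[leLHS]mulr_natl.
  rewrite ler_pdivrMr// natrM natrX exprVn mulrCA mulVf ?mulr1 ?expf_neq0//.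
  rewrite ler_nat size_pmap_sub; apply: leq_trans (count_size _ _) _.
  by rewrite size_map size_iota.
(* [t K] lists the elements of the first [K] blocks. *)
pose t := fix t K := if K is K'.+1 then t K' ++ q K' else [::].
have t_mem k K p : (k < K)%N -> p \in q k -> p \in t K.
  elim: K => // K IH; rewrite ltnS leq_eqVlt mem_cat => /orP[/eqP ->|kK] pq.
    by rewrite pq orbT.
  by rewrite IH.
have t_sum K : recip_sum R (t K) <= 2 - 2 * 2^-1 ^+ K.
  elim: K => [|K IH]; first by rewrite /recip_sum big_nil expr0; lra.
  by rewrite recip_sum_cat exprS; have := q_sum K; lra.
apply/recip_idealP; exists 2 => s us sQ.
have [K sK] := finite_posnat_lt (finite_seq s).
apply: (@le_trans _ _ (recip_sum R (t K))); last first.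
  apply: le_trans (t_sum K) _.
  by rewrite gerBl mulr_ge0// exprn_ge0// invr_ge0.
apply: recip_sum_uniq_sub => // p ps; have [k _ pk] := sQ _ ps.
apply: (t_mem k); last exact/qP.
have [j jk pz] := pk.
by have := sK _ ps; have := zk _ _ jk; have := scale_gt k; rewrite pz /=; lia.
Qed.

End Summable.

(** * No infinite union of blocks is small *)

Lemma point_blocks_positive : positive_blocks fin_ideal point_blocks.
Proof.
split.
- exact: blocks_between_disjoint scale_homo point_blocks_between.
- exact: blocks_between_finite point_blocks_between.
- move=> K Kub /finite_posnat_lt[N /= QN]; have [k Kk Nk] := Kub N.
  have sk : (0 < scale k)%N by exact: leq_ltn_trans (scale_gt k).
  have /QN : (\bigcup_(k in K) point_blocks k) (mkpos sk).
    by exists k => //; exists 0%N.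
  by have := scale_gt k => /=; lia.
Qed.

Lemma eventually_periodic_add A r b j (p q : posnat) :
  eventually_periodic A r b ->
  (b <= val p)%N -> val q = (val p + j * r)%N -> A p <-> A q.
Proof.
move=> [_ _ _ Ar] bp; elim: j q => [|j IH] q qp.
  by have -> : p = q by apply: val_inj; rewrite qp /= addn0.
have x0 : (0 < val p + j * r)%N by have := valP p; lia.
apply: (iff_trans (IH (mkpos x0) erefl)); apply: Ar => /=.
  by move: bp => /=; lia.
by move: qp => /=; rewrite mulSn; lia.
Qed.

Section Positive.
Context (R : realType).

Lemma fin_sub_tile X : fin_ideal X -> tile_ideal R X.
Proof. by move=> /finite_dyadic_null; exact: dyadic_null_tile. Qed.

Lemma fin_sub_banach X : fin_ideal X -> banach_ideal R X.
Proof.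
by move=> /finite_dyadic_null/dyadic_null_sparse; exact: sparse_banach.
Qed.

Lemma fin_sub_density X : fin_ideal X -> density_ideal R X.
Proof. by move=> /fin_sub_banach; exact: banach_le_density. Qed.

Lemma fin_sub_recip X : fin_ideal X -> recip_ideal R X.
Proof.
move=> finX; apply/recip_idealP; exists (recip_sum R (fset_set X)) => s us sX.
by apply: recip_sum_uniq_sub => // p /sX Xp; rewrite in_fset_set// mem_set.
Qed.

(** A tile that contains almost all of infinitely many blocks meets every
residue class modulo its period beyond its starting point, so it contains
everything from there on and has density [1]. *)
Lemma residue_blocks_positive : positive_blocks (tile_ideal R) residue_blocks.
Proof.
split.
- exact: blocks_between_disjoint scale_homo residue_blocks_between.
- move=> k; apply: fin_sub_tile.
  exact: blocks_between_finite residue_blocks_between k.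
move=> K Kub /tile_density0P/(_ 2^-1)[|A [l [tA QA Al l2]]].
  by rewrite invr_gt0.
have [r [b Aper]] := tile_eventually_periodic tA.
have [r0 b0 _ _] := Aper.
have [F /finite_posnat_lt[N FN] QAF] := QA.
have A_full p : (b <= val p)%N -> A p.
  move=> bp; have [k Kk nk] := Kub (maxn (maxn N r) (val p)).
  pose s := (val p %% r)%N; have sr : (s < r)%N by rewrite ltn_mod.
  have sk : (s <= k)%N by lia.
  have rk : (r %| scale k)%N by apply: dvdn_scale; lia.
  have ks := scale_gt k.
  have q0 : (0 < scale k * s.+1 + s)%N by rewrite addn_gt0 muln_gt0; lia.
  have kq : (k < scale k * s.+1 + s)%N.
    by apply: leq_trans ks _; rewrite mulnS -addnA leq_addr.
  have [Aq|Fq] : (A `|` F) (mkpos q0).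
  - by apply: QAF; exists k => //; exists s.
  (* [q] exceeds [p] by a multiple of [r], as both leave the remainder [s]. *)
  - apply/(eventually_periodic_add (q := mkpos q0)
      (j := ((scale k * s.+1) %/ r - val p %/ r)%N) Aper bp) => //.
    have := divn_eq (val p) r; rewrite -/s => pE.
    have pks : (val p <= scale k * s.+1)%N.
      by apply: leq_trans (leq_pmulr _ (ltn0Sn s)); lia.
    rewrite mulnBl divnK ?(dvdn_mulr _ rk)//; by move: pE pks => /=; lia.
  - by have := FN _ Fq => /=; lia.
suff : 2^-1 <= l by lra.
apply: (cvgr_to_ge Al); near=> n.
have bn : (2 * b <= n)%N by near: n; exact: nbhs_infty_ge.
rewrite /density_seq ler_pdivlMr; last by rewrite ltr0n; lia.
have full : (count_in A b.+1 (b + (n - b)) = n - b)%N.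
  by apply: count_in_full => p /andP[bp _]; apply: A_full; exact: ltnW.
have := count_in_suffix A b.+1 (b + (n - b)).
rewrite full subnKC; last by lia.
move: bn; rewrite -(ler_nat R) => + nb; rewrite natrM => bn.
have : n%:R <= (count_in A 1 n)%:R + b%:R :> R by rewrite -natrD ler_nat; lia.
lra.
Unshelve. all: by end_near.
Qed.

(** The block [k] fills a window of length [k + 1]. *)
Lemma interval_blocks_positive :
  positive_blocks (banach_ideal R) interval_blocks.
Proof.
split.
- exact: blocks_between_disjoint scale_homo interval_blocks_between.
- move=> k; apply: fin_sub_banach.
  exact: blocks_between_finite interval_blocks_between k.
move=> K Kub /= /cvgrPdist_lt /(_ 1 ltr01) [N _ QN].
have [k Kk Nk] := Kub N.
have := QN k.+1 (leq_trans Nk (leqnSn k)).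
rewrite /= sub0r normrN ltNge => /negP; apply.
set X := \bigcup_(k in K) _.
apply: (le_trans _ (ler_norm _)).
apply: le_trans (window_max_ub R X k.+1 (scale k)).
rewrite count_in_full ?divff// => p /andP[kp pk]; exists k => //.
by exists (val p - (scale k).+1)%N; move: kp pk => /=; lia.
Qed.

(** Oresme: each of the [j] octaves contributes at least [1 / 2]. *)
Lemma harmonic_dyadic a j :
  j%:R / 2 <= \sum_(2 ^ a <= c < 2 ^ (a + j)) (c.+1%:R)^-1 :> R.
Proof.
elim: j => [|j IH]; first by rewrite mul0r sumr_ge0.
rewrite (@big_cat_nat _ _ _ (2 ^ (a + j)))/= ?leq_expn2 ?leq_addr//; last first.
  by rewrite leq_add2l.
rewrite -natr1 mulrDl lerD// addnS.
apply: (@le_trans _ _ (\sum_(2 ^ (a + j) <= c < 2 ^ (a + j).+1)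
   ((2 ^ (a + j).+1)%:R)^-1 : R)).
  have p0 : 0 < (2 ^ (a + j))%:R :> R by rewrite ltr0n expn_gt0.
  rewrite sumr_const_nat -[leRHS]mulr_natl expnS mul2n -addnn addnK natrD.
  rewrite ler_pdivlMr ?addr_gt0//; lra.
apply: ler_sum_nat => c /andP[_ cj].
by rewrite lef_pV2 ?posrE ?ltr0n ?expn_gt0// ler_nat.
Qed.

Lemma multiple_blocks_sum k : exists s, [/\ uniq s,
  forall p, p \in s -> multiple_blocks k p & 1 <= recip_sum R s].
Proof.
have k2 : (0 < 2 ^ k)%N by rewrite expn_gt0.
have p0 c : (0 < 2 ^ k * c.+1)%N by rewrite muln_gt0 k2.
(* After division by [2 ^ k], the octaves start at [2 ^ a]. *)
pose a := (2 ^ k.+1 - k)%N.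
have ak : (k + a = 2 ^ k.+1)%N.
  by rewrite /a subnKC//; exact/ltnW/ltnW/ltn_expl.
exists [seq mkpos (p0 c) | c <- index_iota (2 ^ a) (2 ^ (a + 2 ^ k.+1))]; split.
- rewrite map_inj_uniq ?iota_uniq// => c d [] /eqP.
  by rewrite eqn_mul2l => /orP[/eqP kk|/eqP[]//]; rewrite kk in k2.
- move=> p /mapP[c]; rewrite mem_index_iota => /andP[ac ca] ->.
  rewrite /multiple_blocks /= dvdn_mulr//= -ak expnD ltn_pmul2l//.
  rewrite ltnS ac/=.
  have -> : (2 ^ k.+2 = k + (a + 2 ^ k.+1))%N by rewrite addnA ak expnS; lia.
  by rewrite expnD leq_pmul2l.
rewrite /recip_sum big_map /=.
apply: (@le_trans _ _ ((2 ^ k)%:R^-1 * ((2 ^ k.+1)%:R / 2))).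
  have kn : (2 ^ k)%:R != 0 :> R by rewrite pnatr_eq0 -lt0n.
  by rewrite expnS natrM mulrAC divff ?mul1r ?mulVf// pnatr_eq0.
apply: (@le_trans _ _ ((2 ^ k)%:R^-1 *
    \sum_(2 ^ a <= c < 2 ^ (a + 2 ^ k.+1)) (c.+1%:R)^-1)).
  by rewrite ler_wpM2l ?invr_ge0// harmonic_dyadic.
by rewrite mulr_sumr; apply: ler_sum => c _; rewrite natrM invfM.
Qed.

(** Blocks far apart are disjoint, and each adds at least [1] to the reciprocal
sum. *)
Lemma multiple_blocks_positive :
  positive_blocks (recip_ideal R) multiple_blocks.
Proof.
split.
- exact: blocks_between_disjoint double_exp_homo multiple_blocks_between.
- move=> k; apply: fin_sub_recip.
  exact: blocks_between_finite multiple_blocks_between k.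
move=> K Kub /recip_idealP[M QM].
have big j : exists s, [/\ uniq s,
    forall p, p \in s -> (\bigcup_(k in K) multiple_blocks k) p &
    j%:R <= recip_sum R s].
  elim: j => [|j [s [us sQ js]]].
    by exists [::]; split; rewrite ?recip_sum_ge0.
  have [N sN] := finite_posnat_lt (finite_seq s).
  have [k Kk Nk] := Kub N; have [t [ut tQ t1]] := multiple_blocks_sum k.
  exists (s ++ t); split.
  - rewrite cat_uniq us ut andbT /=; apply/hasPn => p /tQ /andP[_ /andP[kp _]].
    apply: contraL Nk => /sN pN; rewrite -ltnNge; apply: leq_trans pN.
    rewrite ltnS; apply: leq_trans (ltnW kp).
    have e2 n : (n <= 2 ^ n)%N by exact/ltnW/ltn_expl.
    exact: leq_trans (leqnSn k) (leq_trans (e2 _) (e2 _)).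
  - by move=> p; rewrite mem_cat => /orP[/sQ//|/tQ kp]; exists k.
  - by rewrite recip_sum_cat -natr1 lerD.
have [s [us sQ Ms]] := big (Num.trunc M).+1.
have := lt_le_trans (truncnS_gt M) (le_trans Ms (QM _ us sQ)).
by rewrite ltxx.
Qed.

(** The block [k] makes up half of the integers up to [2 ^ (k + 1)]. *)
Lemma dyadic_blocks_positive : positive_blocks (density_ideal R) dyadic_blocks.
Proof.
split.
- apply: blocks_between_disjoint dyadic_blocks_between => k l kl.
  by rewrite ltnS leq_expn2.
- move=> k; apply: fin_sub_density.
  exact: blocks_between_finite dyadic_blocks_between k.
have h2 : 0 < 2^-1 :> R by rewrite invr_gt0.
move=> K Kub /= /cvgrPdist_lt /(_ _ h2) [N _ QN].
have [k Kk Nk] := Kub N.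
have Nk2 : (N <= 2 ^ k.+1)%N.
  by apply: leq_trans Nk _; exact/ltnW/ltnW/ltn_expl.
have := QN _ Nk2; set X := \bigcup_(k in K) _.
rewrite /= sub0r normrN ltNge => /negP; apply.
apply: (le_trans _ (ler_norm _)); rewrite /density_seq.
rewrite ler_pdivlMr ?ltr0n ?expn_gt0// expnS natrM mulrA mulVf ?mul1r//.
rewrite ler_nat -expnS.
have full : (count_in X (2 ^ k).+1 (2 ^ k + 2 ^ k) = 2 ^ k)%N.
  apply: count_in_full => p pk; exists k => //.
  by rewrite /dyadic_blocks /= expnS mul2n -addnn.
rewrite -{1}full addnn -mul2n -expnS; exact: count_in_suffix.
Qed.

End Positive.

(** * The quotient maps *)

Theorem corollary5p9 (R : realType) :
  let f := fin_ideal in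
  let r := recip_ideal R in
  let d := density_ideal R in
  let b := banach_ideal R in
  let t := tile_ideal R in
  (forall i : ideal,
     [set f; idealI t r; idealI b r; r; t; b; d] i ->
     ~ has_uc_right_inverse (ic0 R i)) /\
  (forall i : ideal,
     [set f; idealI t r; idealI b r; r; t; b] i ->
     ~ has_uc_right_inverse (trace_subspace (ic0 R d) (ic0 R i))) /\
  (forall i : ideal,
     [set f; idealI t r; idealI b r; t] i ->
     ~ has_uc_right_inverse (trace_subspace (ic0 R b) (ic0 R i))) /\
  (forall i : ideal,
     [set f; idealI t r; idealI b r] i ->
     ~ has_uc_right_inverse (trace_subspace (ic0 R r) (ic0 R i))) /\
  (forall i : ideal,
     [set f; idealI t r] i ->
     ~ has_uc_right_inverse (trace_subspace (ic0 R t) (ic0 R i))) /\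
  (forall i : ideal,
     [set f; idealI t r] i ->
     ~ has_uc_right_inverse (trace_subspace (ic0 R (idealI b r)) (ic0 R i))) /\
  ~ has_uc_right_inverse (trace_subspace (ic0 R (idealI t r)) (ic0 R f)).
Proof.
move=> f r d b t.
pose tr := idealI t r; pose br := idealI b r.
have fin_tr X : f X -> tr X.
  by move=> fX; split; [exact: fin_sub_tile|exact: fin_sub_recip].
have fin_br X : f X -> br X.
  by move=> fX; split; [exact: fin_sub_banach|exact: fin_sub_recip].
have point_t : t (\bigcup_k point_blocks k).
  exact/dyadic_null_tile/point_blocks_dyadic_null.
have point_b : b (\bigcup_k point_blocks k).
  exact/sparse_banach/dyadic_null_sparse/point_blocks_dyadic_null.
have point_r : r (\bigcup_k point_blocks k) by exact: block_recip.
have residue_b : b (\bigcup_k residue_blocks k).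
  exact/sparse_banach/residue_blocks_sparse.
have residue_r : r (\bigcup_k residue_blocks k).
  by apply: block_recip => k s _; rewrite mulnS -addnA leq_addr.
have interval_r : r (\bigcup_k interval_blocks k).
  by apply: block_recip => k s _; exact: leq_addr.
have multiple_t : t (\bigcup_k multiple_blocks k).
  exact/dyadic_null_tile/multiple_blocks_dyadic_null.
have multiple_b : b (\bigcup_k multiple_blocks k).
  exact/sparse_banach/dyadic_null_sparse/multiple_blocks_dyadic_null.
have pos_f := point_blocks_positive.
have pos_t := residue_blocks_positive R.
have pos_b := interval_blocks_positive R.
have pos_r := multiple_blocks_positive R.
have pos_d := dyadic_blocks_positive R.
have residue_tr : positive_blocks tr residue_blocks.
  apply: positive_blocks_sub pos_t => [X []//|k]; apply: fin_tr.
  exact: blocks_between_finite residue_blocks_between k.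
have interval_br : positive_blocks br interval_blocks.
  apply: positive_blocks_sub pos_b => [X []//|k]; apply: fin_br.
  exact: blocks_between_finite interval_blocks_between k.
have multiple_tr : positive_blocks tr multiple_blocks.
  apply: positive_blocks_sub pos_r => [X []//|k]; apply: fin_tr.
  exact: blocks_between_finite multiple_blocks_between k.
have multiple_br : positive_blocks br multiple_blocks.
  apply: positive_blocks_sub pos_r => [X []//|k]; apply: fin_br.
  exact: blocks_between_finite multiple_blocks_between k.
split.
  move=> i [[[[[[->|->]|->]|->]|->]|->]|->].
  - exact: (no_uc_right_inverse_linfty pos_f).
  - exact: (no_uc_right_inverse_linfty residue_tr).
  - exact: (no_uc_right_inverse_linfty interval_br).
  - exact: (no_uc_right_inverse_linfty pos_r).
  - exact: (no_uc_right_inverse_linfty pos_t).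
  - exact: (no_uc_right_inverse_linfty pos_b).
  - exact: (no_uc_right_inverse_linfty pos_d).
split.
  move=> i [[[[[->|->]|->]|->]|->]|->].
  - exact/(no_uc_right_inverse_trace pos_f)/banach_le_density.
  - exact/(no_uc_right_inverse_trace residue_tr)/banach_le_density.
  - exact/(no_uc_right_inverse_trace interval_br)/recip_le_density.
  - exact/(no_uc_right_inverse_trace pos_r)/banach_le_density.
  - exact/(no_uc_right_inverse_trace pos_t)/banach_le_density.
  - exact/(no_uc_right_inverse_trace pos_b)/recip_le_density.
split.
  move=> i [[[->|->]|->]|->].
  - exact: (no_uc_right_inverse_trace pos_f).
  - exact: (no_uc_right_inverse_trace residue_tr).
  - exact: (no_uc_right_inverse_trace multiple_br).
  - exact: (no_uc_right_inverse_trace pos_t).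
split.
  move=> i [[->|->]|->].
  - exact: (no_uc_right_inverse_trace pos_f).
  - exact: (no_uc_right_inverse_trace residue_tr).
  - exact: (no_uc_right_inverse_trace interval_br).
split.
  move=> i [->|->].
  - exact: (no_uc_right_inverse_trace pos_f).
  - exact: (no_uc_right_inverse_trace multiple_tr).
split.
  move=> i [->|->].
  - exact: (no_uc_right_inverse_trace pos_f).
  - exact: (no_uc_right_inverse_trace residue_tr).
exact: (no_uc_right_inverse_trace pos_f).
Qed.
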